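(* Let $\varphi\in C^{\infty}(\mathbb{R})$ be an even function such that $\varphi''(\sigma)>0$ for every $\sigma\in[0,1)$, $\varphi''(1)=0$, $\varphi''(\sigma)<0$ for every $\sigma>1$, and $\varphi'''(1)<0$. Let $0<r_{1}<r_{3}<r_{4}<r_{5}<r_{2}$ and $T>0$ be real numbers, and let $u\in C^{1}\left((r_{1},r_{2})\times[0,T)\right)$ be a solution of $$u_{t}=\left(\varphi'(u_{r})\right)_{r}+\frac{\varphi'(u_{r})}{r}\quad\text{in }(r_{1},r_{2})\times[0,T)$$ such that $$|u_{r}(r_{3},0)|<1,\qquad |u_{r}(r_{5},0)|<1,\qquad u_{r}(r_{4},0)>1+\frac{r_{2}(r_{2}-r_{1})}{r_{1}^{2}}\sqrt{\frac{\varphi'(1)}{2|\varphi'''(1)|}}.$$ Then $$T\leq\frac{r_{2}(r_{2}-r_{1})}{\sqrt{2\varphi'(1)|\varphi'''(1)|}}.$$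
   Context: Subscripts $r,t$ denote partial derivatives (one-sided in $t$ at $t=0$). Since $u$ is only assumed to be of class $C^{1}$, the equation is understood in the following sense: for every $t$ the function $r\mapsto\varphi'(u_{r}(r,t))$ is differentiable, and its derivative $(\varphi'(u_r))_r$ satisfies the equation at every point $(r,t)\in(r_1,r_2)\times[0,T)$. *)

(* Defs.v *)
From Stdlib Require Import Reals.
From Coquelicot Require Import Coquelicot.
Open Scope R_scope.

(* Derivative of [f] at [x] relative to [D]: [is_derive] with the filter
   [locally x] restricted to [D], hence the right derivative when [x] is the
   left end point of the interval [D]. *)
Definition is_derive_within (D : R -> Prop) (f : R -> R) (x l : R) : Prop :=
  filterdiff f (within D (locally x)) (fun y : R => scal y l).

Definition smooth (f : R -> R) : Prop :=
  forall (n : nat) (x : R), ex_derive_n f n x.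

Definition even_fun (f : R -> R) : Prop := forall x : R, f (- x) = f x.

Definition time_interval (T : R) : R -> Prop := fun t => 0 <= t < T.

Definition cylinder (r1 r2 T : R) : R * R -> Prop :=
  fun p => r1 < fst p < r2 /\ time_interval T (snd p).

(* Functions on the cylinder are total functions [R -> R -> R] whose values
   outside of it are irrelevant. The set is open in [r], so the two-sided
   derivative is the right one here; in [t] it is not, and the derivative is
   taken relative to [time_interval T]. *)
Definition d_r (u : R -> R -> R) (r t : R) : R := Derive (fun s => u s t) r.

Definition C1_cylinder (r1 r2 T : R) (u : R -> R -> R) : Prop :=
  exists u_t : R -> R -> R,
    (forall r t : R, cylinder r1 r2 T (r, t) ->
       ex_derive (fun s => u s t) r /\
       is_derive_within (time_interval T) (fun s => u r s) t (u_t r t)) /\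
    continuous_on (cylinder r1 r2 T) (fun p => d_r u (fst p) (snd p)) /\
    continuous_on (cylinder r1 r2 T) (fun p => u_t (fst p) (snd p)).

Definition flux (phi : R -> R) (u : R -> R -> R) (r t : R) : R :=
  Derive phi (d_r u r t).

Definition radial_solution (phi : R -> R) (r1 r2 T : R) (u : R -> R -> R)
  : Prop :=
  forall r t : R, cylinder r1 r2 T (r, t) ->
    ex_derive (fun s => flux phi u s t) r /\
    is_derive_within (time_interval T) (fun s => u r s) t
      (d_r (flux phi u) r t + flux phi u r t / r).

(* Main.v *)
Require Import Defs.
From Stdlib Require Import Reals Lra Psatz List Classical ClassicalEpsilon.
From Coquelicot Require Import Coquelicot.
Open Scope R_scope.

(** Three monotone features of the evolution carry the proof. Write
    [p] for the slope [u_r], [F] for the flux function [phi'] and [q] for the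
    space derivative of [F p], so that [u_t = q + F p / r]. The function [F]
    rises on [[0,1]] to its maximum [M = F 1] and falls afterwards; with
    [k = - F'' 1], one has [M - F (1 - s) ~ (k/2) s^2]. In particular [q = 0]
    wherever [p = 1] ([flux_critical]).

    - A point with [p < 1] keeps that property ([subcritical_persists]). At the
      threshold, [p_t = (F p)_rr + (F p)_r / r - F p / r^2] is at most
      [- M / r^2 < 0]: the curvature term of radial solutions pushes the slope
      down. This leaves room for a time-independent barrier, whose flux is
      below [M] by a small quadratic bump.

    - The subcritical region invades the rest with any speed [c] such that
      [c^2 < 2 k M / r2^2] ([subcritical_front]). Formally an interface where
      [p] crosses [1] with slope [s] moves with speed [k s + M / (r^2 s)], and
      this is bounded below whatever [s] is. The rigorous substitute for this
      inequality between arithmetic and geometric means is a weighted integral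
      [deficit] of [1 - p] just ahead of a point [alpha + c t]: at a point where
      it is maximal with respect to its upper end, its time derivative is the
      integral of a positive definite quadratic form ([deficit_dt_pos]).

    - Between two subcritical points the maximal slope decreases at most with
      rate [M / r1^2] ([supercritical_decay]): at a supercritical maximum of
      [p] the flux is minimal, so only the term [- F p / r^2] can lower [p].

    Let [t0] be the bound claimed for [T] and suppose [t0 < T]. The speed
    [c = (r5 - r3) / t0] is admissible because [r5 - r3 < r2 - r1], so a
    subcritical front that starts at [r3] reaches [r5] at time [t0] and leaves
    no room for a supercritical slope; but the slope at [r4] is so large that
    it would have to stay above [1] somewhere until then.

    The solution is only of class [C^1], so [p] has no time derivative and no
    second space derivative. All comparisons are therefore made on [u] itself:
    instead of comparing [p] with the slope of a barrier [G], one maximises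
    [u(r,t) - u(s,t) - (G(r,t) - G(s,t))] over [s <= r] and [t]
    ([two_point_maximum]). At an interior maximum the slopes agree at both
    points, the second derivatives are replaced by the sign of the derivative
    of a difference of fluxes ([second_order_test]), and the time derivative
    involves only [u_t]. *)

(** * Maxima of continuous functions and signs of derivatives *)

Lemma exists_max_list {A : Type} (g : A -> R) (l : list A) (a : A) :
  exists m, (m = a \/ In m l) /\ forall x, In x l -> g x <= g m.
Proof.
  induction l as [|b l [m [Hm Hmax]]].
  - exists a. split; [now left | intros x []].
  - destruct (Rle_dec (g b) (g m)) as [Hb | Hb].
    + exists m. split.
      * destruct Hm; [now left | right; now right].
      * intros x [<- | Hx]; auto.
    + exists b. split; [right; now left |].
      intros x [<- | Hx]; [lra |]. specialize (Hmax x Hx). lra.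
Qed.

(** Were there no maximum, each point of [K] would have a neighbourhood on which
    [f] stays below some larger value taken on [K]; the largest of finitely
    many such values would exceed itself. *)
Lemma exists_max_compact (n : nat) (K : Compactness.Tn n R -> Prop)
  (f : Compactness.Tn n R -> R) (a b x0 : Compactness.Tn n R) :
  K x0 ->
  (forall x, K x -> bounded_n n a b x) ->
  (forall x, ~ K x -> exists d : posreal,
     forall y, close_n n d y x -> ~ K y) ->
  (forall x, K x -> forall eps, 0 < eps -> exists d : posreal,
     forall y, K y -> close_n n d y x -> f y < f x + eps) ->
  exists x, K x /\ forall y, K y -> f y <= f x.
Proof.
  intros Hx0 Hbox Hclosed Husc.
  apply NNPP. intros Hno.
  assert (Hbetter : forall x, K x -> exists y, K y /\ f x < f y).
  { intros x Kx. apply NNPP. intros H. apply Hno. exists x. split; [exact Kx |].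
    intros y Ky. apply Rnot_lt_le. intros Hlt. apply H. now exists y. }
  assert (Hloc : forall x, exists dy : posreal * Compactness.Tn n R,
     K (snd dy) /\
     forall y, K y -> close_n n (fst dy) y x -> f y < f (snd dy)).
  { intros x. destruct (classic (K x)) as [Kx | nKx].
    - destruct (Hbetter x Kx) as [y [Ky Hy]].
      destruct (Husc x Kx (f y - f x)) as [d Hd]; [lra |].
      exists (d, y). split; [exact Ky |]. intros z Kz Hz. simpl.
      specialize (Hd z Kz Hz). lra.
    - destruct (Hclosed x nKx) as [d Hd]. exists (d, x0).
      split; [exact Hx0 |]. intros y Ky Hy. now elim (Hd y Hy). }
  set (F := fun x => proj1_sig (constructive_indefinite_description _ (Hloc x))).
  assert (HF : forall x, K (snd (F x)) /\
     forall y, K y -> close_n n (fst (F x)) y x -> f y < f (snd (F x))).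
  { intros x. exact (proj2_sig (constructive_indefinite_description _ (Hloc x))). }
  apply (compactness_list n a b (fun x => fst (F x))). intros [l Hl].
  destruct (exists_max_list (fun x => f (snd (F x))) l x0) as [m [_ Hmax]].
  destruct (HF m) as [Km _].
  destruct (Hl _ (Hbox _ Km)) as [z [Hz [_ Hclose]]].
  pose proof (proj2 (HF z) _ Km Hclose). specialize (Hmax z Hz). simpl in Hmax.
  lra.
Qed.

(** Two points are compared on an interval whose left end follows a front and
    whose right end is at rest. *)
Definition trapezoid (alpha c beta t1 t2 s r t : R) : Prop :=
  t1 <= t <= t2 /\ alpha + c * t <= s <= r /\ r <= beta.

Lemma exists_max_trapezoid (alpha c beta t1 t2 : R) (f : R -> R -> R -> R)
  (s0 r0 t0 : R) :
  0 <= c ->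
  trapezoid alpha c beta t1 t2 s0 r0 t0 ->
  (forall s r t, trapezoid alpha c beta t1 t2 s r t ->
     forall eps, 0 < eps -> exists d, 0 < d /\
     forall s' r' t', trapezoid alpha c beta t1 t2 s' r' t' ->
       Rabs (s' - s) < d -> Rabs (r' - r) < d -> Rabs (t' - t) < d ->
       Rabs (f s' r' t' - f s r t) < eps) ->
  exists s r t, trapezoid alpha c beta t1 t2 s r t /\
    forall s' r' t', trapezoid alpha c beta t1 t2 s' r' t' ->
      f s' r' t' <= f s r t.
Proof.
  intros Hc H0 Hcont.
  set (K := fun x : Compactness.Tn 3 R =>
    let '(s, (r, (t, _))) := x in trapezoid alpha c beta t1 t2 s r t).
  set (g := fun x : Compactness.Tn 3 R => let '(s, (r, (t, _))) := x in f s r t).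
  destruct (exists_max_compact 3 K g
    (alpha + c * t1, (alpha + c * t1, (t1, tt))) (beta, (beta, (t2, tt)))
    (s0, (r0, (t0, tt)))) as [[s [r [t []]]] [HK Hmax]].
  - exact H0.
  - intros [s [r [t []]]] [Ht [Hs Hr]]. simpl.
    assert (c * t1 <= c * t) by (apply Rmult_le_compat_l; lra).
    repeat split; lra.
  - intros [s [r [t []]]] HK. simpl in HK.
    assert (Hgap : exists e, 0 < e /\
      (t <= t1 - e \/ t2 + e <= t \/ s <= alpha + c * t - e \/ r <= s - e
       \/ beta + e <= r)).
    { unfold trapezoid in HK.
      destruct (Rle_dec t1 t); [| exists (t1 - t); lra].
      destruct (Rle_dec t t2); [| exists (t - t2); lra].
      destruct (Rle_dec (alpha + c * t) s); [| exists (alpha + c * t - s); lra].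
      destruct (Rle_dec s r); [| exists (s - r); lra].
      destruct (Rle_dec r beta); [tauto | exists (r - beta); lra]. }
    destruct Hgap as [e [He Hgap]].
    assert (Hd : 0 < e / (2 * (1 + c))) by (apply Rdiv_lt_0_compat; lra).
    exists (mkposreal _ Hd). intros [s' [r' [t' []]]]. cbn [close_n pos].
    set (d := e / (2 * (1 + c))) in *.
    assert (Hde : 2 * d + 2 * (c * d) = e) by (unfold d; field; lra).
    assert (0 <= c * d) by (apply Rmult_le_pos; lra).
    intros [Hs [Hr [Ht _]]] [[Ht1 Ht2] [[Hs1 Hs2] Hr1]].
    apply Rabs_def2 in Hs. apply Rabs_def2 in Hr. apply Rabs_def2 in Ht.
    assert (c * t <= c * (t' + d)) by (apply Rmult_le_compat_l; lra).
    lra.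
  - intros [s [r [t []]]] HK eps Heps.
    destruct (Hcont s r t HK eps Heps) as [d [Hd Hd']].
    exists (mkposreal d Hd). intros [s' [r' [t' []]]] HK'. simpl.
    intros [Hs [Hr [Ht _]]].
    specialize (Hd' s' r' t' HK' Hs Hr Ht). apply Rabs_def2 in Hd'. lra.
  - exists s, r, t. split; [exact HK |]. intros s' r' t' HK'.
    exact (Hmax (s', (r', (t', tt))) HK').
Qed.

Lemma is_derive_within_bound (D : R -> Prop) (g : R -> R) (x l : R) :
  is_derive_within D g x l -> forall eps, 0 < eps -> exists d, 0 < d /\
  forall y, D y -> Rabs (y - x) < d ->
    Rabs (g y - g x - (y - x) * l) <= eps * Rabs (y - x).
Proof.
  intros [_ H] eps Heps.
  assert (Hlim : is_filter_lim (within D (locally x)) x).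
  { intros P HP. unfold within. apply filter_imp with (2 := HP). now intros. }
  destruct (H x Hlim (mkposreal eps Heps)) as [d Hd].
  exists (pos d). split; [apply cond_pos |]. intros y Dy Hy.
  exact (Hd y Hy Dy).
Qed.

(** Beyond [t] the set [time_interval T] contains a full right neighbourhood, so
    a maximum from the right can be tested even at [t = 0]. *)
Lemma is_derive_within_nonpos (T : R) (g : R -> R) (t l eta : R) :
  is_derive_within (time_interval T) g t l -> 0 <= t < T -> 0 < eta ->
  (forall t', t < t' < t + eta -> t' < T -> g t' <= g t) -> l <= 0.
Proof.
  intros Hd Ht Heta Hmax. apply Rnot_lt_le. intros Hl.
  destruct (is_derive_within_bound _ _ _ _ Hd (l / 2)) as [d [Hd0 Hb]]; [lra |].
  set (h := Rmin (Rmin eta (T - t)) d / 2).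
  assert (Hh : 0 < h /\ h < eta /\ h < T - t /\ h < d).
  { unfold h. assert (0 < Rmin (Rmin eta (T - t)) d) by (repeat apply Rmin_pos; lra).
    pose proof (Rmin_l (Rmin eta (T - t)) d). pose proof (Rmin_r (Rmin eta (T - t)) d).
    pose proof (Rmin_l eta (T - t)). pose proof (Rmin_r eta (T - t)). lra. }
  assert (Hg : g (t + h) <= g t) by (apply Hmax; lra).
  specialize (Hb (t + h)). replace (t + h - t) with h in Hb by ring.
  rewrite (Rabs_pos_eq h) in Hb by lra.
  assert (Hb' := Hb ltac:(unfold time_interval; lra) ltac:(lra)).
  apply Rabs_le_between in Hb'. nra.
Qed.

Lemma is_derive_within_nonneg (T : R) (g : R -> R) (t l eta : R) :
  is_derive_within (time_interval T) g t l -> 0 < t < T -> 0 < eta ->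
  (forall t', t - eta < t' < t -> 0 <= t' -> g t' <= g t) -> 0 <= l.
Proof.
  intros Hd Ht Heta Hmax. apply Rnot_lt_le. intros Hl.
  destruct (is_derive_within_bound _ _ _ _ Hd (- l / 2)) as [d [Hd0 Hb]]; [lra |].
  set (h := Rmin (Rmin eta t) d / 2).
  assert (Hh : 0 < h /\ h < eta /\ h < t /\ h < d).
  { unfold h. assert (0 < Rmin (Rmin eta t) d) by (repeat apply Rmin_pos; lra).
    pose proof (Rmin_l (Rmin eta t) d). pose proof (Rmin_r (Rmin eta t) d).
    pose proof (Rmin_l eta t). pose proof (Rmin_r eta t). lra. }
  assert (Hg : g (t - h) <= g t) by (apply Hmax; lra).
  specialize (Hb (t - h)). replace (t - h - t) with (- h) in Hb by ring.
  rewrite Rabs_Ropp, (Rabs_pos_eq h) in Hb by lra.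
  assert (Hb' := Hb ltac:(unfold time_interval; lra) ltac:(lra)).
  apply Rabs_le_between in Hb'. nra.
Qed.

Lemma is_derive_bound (g : R -> R) (x l : R) :
  is_derive g x l -> forall eps, 0 < eps -> exists d, 0 < d /\
  forall y, Rabs (y - x) < d ->
    Rabs (g y - g x - (y - x) * l) <= eps * Rabs (y - x).
Proof.
  intros [_ H] eps Heps.
  assert (Hlim : is_filter_lim (locally x) x) by (intros P HP; exact HP).
  destruct (H x Hlim (mkposreal eps Heps)) as [d Hd].
  exists (pos d). split; [apply cond_pos |]. intros y Hy. exact (Hd y Hy).
Qed.

Lemma is_derive_within_minus (D : R -> Prop) (f g : R -> R) (x lf lg : R) :
  is_derive_within D f x lf -> is_derive_within D g x lg ->
  is_derive_within D (fun y => f y - g y) x (lf - lg).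
Proof.
  intros Hf Hg. unfold is_derive_within.
  apply filterdiff_ext_lin with (fun y : R => minus (scal y lf) (scal y lg)).
  - exact (filterdiff_minus_fct f g _ _ Hf Hg).
  - intros y. unfold scal, minus, plus, opp; simpl. unfold mult; simpl. ring.
Qed.

Lemma is_derive_within_linear (D : R -> Prop) (a b x : R) :
  is_derive_within D (fun y => a + b * y) x b.
Proof.
  assert (Hd : is_derive (fun y => a + b * y) x b).
  { auto_derive; [exact I | ring]. }
  split; [exact (proj1 Hd) |].
  intros y _ eps. apply filter_forall. intros z.
  unfold scal, minus, plus, opp, norm; simpl. unfold mult, abs; simpl.
  replace (a + b * z + - (a + b * y) + - ((z + - y) * b)) with 0 by ring.
  rewrite Rabs_R0. apply Rmult_le_pos; [left; apply cond_pos | apply Rabs_pos].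
Qed.
Lemma mean_value (g q : R -> R) (a b : R) :
  a < b -> (forall x, a <= x <= b -> is_derive g x (q x)) ->
  exists c, a < c < b /\ g b - g a = q c * (b - a).
Proof.
  intros Hab Hg. destruct (MVT_cor2 g q a b Hab) as [c [Hc Hc']].
  - intros c Hc. apply is_derive_Reals, Hg, Hc.
  - exists c. tauto.
Qed.

Lemma lipschitz_of_derive (g q : R -> R) (a d B x : R) :
  (forall y, Rabs (y - a) < d -> is_derive g y (q y) /\ Rabs (q y) <= B) ->
  Rabs (x - a) < d -> Rabs (g x - g a) <= B * Rabs (x - a).
Proof.
  intros Hg Hx. apply Rabs_def2 in Hx.
  assert (Hlt : forall y z, y < z -> a - d < y -> z < a + d ->
    Rabs (g z - g y) <= B * Rabs (z - y)).
  { intros y z Hyz Hy Hz. destruct (mean_value g q y z Hyz) as [c [Hc ->]].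
    - intros c Hc. apply Hg. apply Rabs_def1; lra.
    - rewrite Rabs_mult. apply Rmult_le_compat_r; [apply Rabs_pos |].
      apply Hg. apply Rabs_def1; lra. }
  destruct (Rtotal_order a x) as [H | [<- | H]].
  - apply Hlt; lra.
  - rewrite !Rminus_diag, Rabs_R0. lra.
  - rewrite (Rabs_minus_sym (g x)), (Rabs_minus_sym x). apply Hlt; lra.
Qed.

Lemma is_derive_nonpos (g : R -> R) (x l eta : R) :
  is_derive g x l -> 0 < eta ->
  (forall y, x < y < x + eta -> g y <= g x) -> l <= 0.
Proof.
  intros Hd Heta Hmax. apply Rnot_lt_le. intros Hl.
  destruct (is_derive_bound _ _ _ Hd (l / 2)) as [d [Hd0 Hb]]; [lra |].
  assert (Hm : 0 < Rmin eta d) by (apply Rmin_pos; lra).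
  pose proof (Rmin_l eta d). pose proof (Rmin_r eta d).
  set (h := Rmin eta d / 2) in *. assert (0 < h < eta /\ h < d) by (unfold h; lra).
  assert (Hg : g (x + h) <= g x) by (apply Hmax; lra).
  specialize (Hb (x + h)). replace (x + h - x) with h in Hb by ring.
  rewrite (Rabs_pos_eq h) in Hb by lra.
  specialize (Hb ltac:(lra)). apply Rabs_le_between in Hb. nra.
Qed.

Lemma is_derive_reflect (g : R -> R) (x l : R) :
  is_derive g x l -> is_derive (fun y => g (- y)) (- x) (- l).
Proof.
  intros Hg. replace (- l) with (scal (- 1) l)
    by (unfold scal; simpl; unfold mult; simpl; ring).
  apply (is_derive_comp g Ropp).
  - now rewrite Ropp_involutive.
  - auto_derive; [exact I | ring].
Qed.

Lemma is_derive_nonneg (g : R -> R) (x l eta : R) :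
  is_derive g x l -> 0 < eta ->
  (forall y, x - eta < y < x -> g y <= g x) -> 0 <= l.
Proof.
  intros Hd Heta Hmax.
  assert (- l <= 0); [| lra].
  apply (is_derive_nonpos (fun y => g (- y)) (- x) (- l) eta); auto.
  - now apply is_derive_reflect.
  - intros y Hy. rewrite Ropp_involutive. apply Hmax. lra.
Qed.

(** A substitute for [g''(x) <= 0] at a local maximum of [g] when [g' = q] is
    merely continuous: [w] is any differentiable function that is positive only
    where [q] is, such as a difference of fluxes. If [w'(x) > 0] then [q > 0] to
    the right of [x], and [g] would increase there. *)
Lemma second_order_test (g q w : R -> R) (x d eta : R) :
  0 < eta ->
  (forall y, x <= y < x + eta -> is_derive g y (q y)) ->
  (forall y, x < y < x + eta -> g y <= g x) ->
  (forall y, x < y < x + eta -> 0 < w y -> 0 < q y) ->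
  w x = 0 -> is_derive w x d -> d <= 0.
Proof.
  intros Heta Hg Hmax Hsign Hwx Hw. apply Rnot_lt_le. intros Hd.
  destruct (is_derive_bound _ _ _ Hw (d / 2)) as [e [He Hb]]; [lra |].
  assert (Hm : 0 < Rmin eta e) by (apply Rmin_pos; lra).
  pose proof (Rmin_l eta e). pose proof (Rmin_r eta e).
  set (h := Rmin eta e / 2) in *. assert (0 < h < eta /\ h < e) by (unfold h; lra).
  destruct (mean_value g q x (x + h)) as [c [Hc Hc']]; [lra | intros; apply Hg; lra |].
  assert (Hgh : g (x + h) <= g x) by (apply Hmax; lra).
  assert (Hwc : 0 < w c).
  { specialize (Hb c). rewrite (Rabs_pos_eq (c - x)) in Hb by lra.
    specialize (Hb ltac:(lra)). apply Rabs_le_between in Hb. rewrite Hwx in Hb. nra. }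
  specialize (Hsign c ltac:(lra) Hwc). nra.
Qed.

(** * The flux *)

(** [F] and [F1] stand for [phi'] and [phi''], and [k] for [- phi'''(1)]. *)
Record threshold_flux (F F1 : R -> R) (k : R) : Prop := {
  flux_derive : forall x, is_derive F x (F1 x);
  flux_0 : F 0 = 0;
  flux_rising : forall x, 0 <= x < 1 -> 0 < F1 x;
  flux_falling : forall x, 1 < x -> F1 x < 0;
  flux_top : F1 1 = 0;
  flux_curvature : is_derive F1 1 (- k);
  flux_curvature_pos : 0 < k }.

Lemma flux_incr F F1 k : threshold_flux F F1 k ->
  forall x y, 0 <= x -> x < y -> y <= 1 -> F x < F y.
Proof.
  intros HF x y Hx Hxy Hy.
  destruct (mean_value F F1 x y Hxy) as [c [Hc Hc']].
  - intros z _. apply (flux_derive _ _ _ HF).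
  - pose proof (flux_rising _ _ _ HF c ltac:(lra)). nra.
Qed.

Lemma flux_decr F F1 k : threshold_flux F F1 k ->
  forall x y, 1 <= x -> x < y -> F y < F x.
Proof.
  intros HF x y Hx Hxy.
  destruct (mean_value F F1 x y Hxy) as [c [Hc Hc']].
  - intros z _. apply (flux_derive _ _ _ HF).
  - pose proof (flux_falling _ _ _ HF c ltac:(lra)). nra.
Qed.

Lemma flux_le_max F F1 k : threshold_flux F F1 k ->
  forall x, 0 <= x -> F x <= F 1.
Proof.
  intros HF x Hx. destruct (Rtotal_order x 1) as [H | [-> | H]].
  - left. apply (flux_incr _ _ _ HF); lra.
  - lra.
  - left. apply (flux_decr _ _ _ HF); lra.
Qed.

Lemma flux_max_pos F F1 k : threshold_flux F F1 k -> 0 < F 1.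
Proof.
  intros HF. rewrite <- (flux_0 _ _ _ HF). apply (flux_incr _ _ _ HF); lra.
Qed.

Lemma flux_incr_inv F F1 k : threshold_flux F F1 k ->
  forall x y, 0 <= x <= 1 -> 0 <= y <= 1 -> F x < F y -> x < y.
Proof.
  intros HF x y Hx Hy H. apply Rnot_le_lt. intros [Hyx | Hyx].
  - pose proof (flux_incr _ _ _ HF y x). lra.
  - subst. lra.
Qed.

(** On the subcritical side [F 1 - F] is at least quadratic with any constant
    below [k / 2], because [F1] vanishes at [1] with slope [- k]. *)
Lemma flux_quadratic_gap F F1 k : threshold_flux F F1 k ->
  forall k', k' < k -> exists s, 0 < s < 1 /\
  forall x, 1 - s < x <= 1 -> k' / 2 * (1 - x) ^ 2 <= F 1 - F x.
Proof.
  intros HF k' Hk'.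
  destruct (is_derive_bound _ _ _ (flux_curvature _ _ _ HF) (k - k'))
    as [d [Hd Hb]]; [lra |].
  exists (Rmin d (1 / 2)). pose proof (Rmin_l d (1/2)). pose proof (Rmin_r d (1/2)).
  assert (0 < Rmin d (1 / 2)) by (apply Rmin_pos; lra).
  split; [lra |]. intros x Hx.
  destruct (Req_dec x 1) as [-> | Hx1]; [simpl; lra |].
  destruct (mean_value (fun y => F y + k' / 2 * (1 - y) ^ 2)
    (fun y => F1 y - k' * (1 - y)) x 1) as [c [Hc Hc']]; [lra | |].
  - intros y _.
    apply (is_derive_plus F (fun y => k' / 2 * (1 - y) ^ 2) y (F1 y)).
    + apply (flux_derive _ _ _ HF).
    + auto_derive; [exact I | field].
  - specialize (Hb c). rewrite (flux_top _ _ _ HF), (Rabs_left1 (c - 1)) in Hb by lra.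
    specialize (Hb ltac:(lra)). apply Rabs_le_between in Hb.
    assert (0 <= F1 c - k' * (1 - c)) by nra. nra.
Qed.

(** * Solutions *)

(** Continuity of [q = (F u_r)_r] is not postulated; it follows from that of
    [f = u_t] and [p = u_r] by the equation. *)
Record flux_solution (F : R -> R) (r1 r2 T : R) (u p q f : R -> R -> R)
  : Prop := {
  sol_r1 : 0 < r1;
  sol_du : forall r t, cylinder r1 r2 T (r, t) ->
    is_derive (fun s => u s t) r (p r t);
  sol_dt : forall r t, cylinder r1 r2 T (r, t) ->
    is_derive_within (time_interval T) (u r) t (f r t);
  sol_dflux : forall r t, cylinder r1 r2 T (r, t) ->
    is_derive (fun s => F (p s t)) r (q r t);
  sol_eq : forall r t, cylinder r1 r2 T (r, t) ->
    f r t = q r t + F (p r t) / r;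
  sol_p_cont : forall r t, cylinder r1 r2 T (r, t) -> forall eps, 0 < eps ->
    exists d, 0 < d /\ forall r' t', cylinder r1 r2 T (r', t') ->
      Rabs (r' - r) < d -> Rabs (t' - t) < d -> Rabs (p r' t' - p r t) < eps;
  sol_f_cont : forall r t, cylinder r1 r2 T (r, t) -> forall eps, 0 < eps ->
    exists d, 0 < d /\ forall r' t', cylinder r1 r2 T (r', t') ->
      Rabs (r' - r) < d -> Rabs (t' - t) < d -> Rabs (f r' t' - f r t) < eps }.

Lemma cylinder_intro r1 r2 T r t :
  r1 < r < r2 -> 0 <= t < T -> cylinder r1 r2 T (r, t).
Proof. intros Hr Ht. now split. Qed.

Lemma gradient_near F r1 r2 T u p q f : flux_solution F r1 r2 T u p q f ->
  forall r t, r1 < r < r2 -> 0 <= t < T -> forall eps, 0 < eps ->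
  exists d, 0 < d /\ forall r' t', Rabs (r' - r) < d -> Rabs (t' - t) < d ->
    0 <= t' < T -> r1 < r' < r2 /\ p r t - eps < p r' t' < p r t + eps.
Proof.
  intros Sol r t Hr Ht eps Heps.
  destruct (sol_p_cont _ _ _ _ _ _ _ _ Sol r t (cylinder_intro _ _ _ _ _ Hr Ht) eps Heps)
    as [d [Hd Hc]].
  set (e := Rmin d (Rmin (r - r1) (r2 - r))).
  pose proof (Rmin_l d (Rmin (r - r1) (r2 - r))).
  pose proof (Rmin_r d (Rmin (r - r1) (r2 - r))).
  pose proof (Rmin_l (r - r1) (r2 - r)). pose proof (Rmin_r (r - r1) (r2 - r)).
  exists e. split; [unfold e; repeat apply Rmin_pos; lra |].
  fold e in H, H0. intros r' t' Hr' Ht' HT.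
  assert (Hin : r1 < r' < r2) by (apply Rabs_def2 in Hr'; lra).
  split; [exact Hin |].
  specialize (Hc r' t' (cylinder_intro _ _ _ _ _ Hin HT) ltac:(lra) ltac:(lra)).
  apply Rabs_def2 in Hc. lra.
Qed.

Lemma solution_continuous F r1 r2 T u p q f : flux_solution F r1 r2 T u p q f ->
  forall r t, r1 < r < r2 -> 0 <= t < T -> forall eps, 0 < eps ->
  exists d, 0 < d /\ forall r' t', Rabs (r' - r) < d -> Rabs (t' - t) < d ->
    0 <= t' < T -> Rabs (u r' t' - u r t) < eps.
Proof.
  intros Sol r t Hr Ht eps Heps.
  destruct (gradient_near _ _ _ _ _ _ _ _ Sol r t Hr Ht 1 ltac:(lra)) as [d1 [Hd1 H1]].
  destruct (is_derive_within_bound _ _ _ _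
    (sol_dt _ _ _ _ _ _ _ _ Sol r t (cylinder_intro _ _ _ _ _ Hr Ht)) 1 ltac:(lra))
    as [d2 [Hd2 H2]].
  set (B := Rabs (p r t) + 1). set (C := Rabs (f r t) + 1).
  assert (HB : 0 < B) by (unfold B; pose proof (Rabs_pos (p r t)); lra).
  assert (HC : 0 < C) by (unfold C; pose proof (Rabs_pos (f r t)); lra).
  set (d := Rmin (Rmin d1 d2) (eps / (B + C))).
  assert (Hdd : 0 < d /\ d <= d1 /\ d <= d2 /\ d <= eps / (B + C)).
  { unfold d. repeat split.
    - repeat apply Rmin_pos; try lra. apply Rdiv_lt_0_compat; lra.
    - eapply Rle_trans; [apply Rmin_l | apply Rmin_l].
    - eapply Rle_trans; [apply Rmin_l | apply Rmin_r].
    - apply Rmin_r. }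
  exists d. split; [tauto |]. intros r' t' Hr' Ht' HT.
  assert (Hsp : Rabs (u r' t' - u r t') <= B * Rabs (r' - r)).
  { apply (lipschitz_of_derive (fun s => u s t') (fun s => p s t') r d1); [| lra].
    intros y Hy. destruct (H1 y t' Hy ltac:(lra) HT) as [Hin Hp]. split.
    - now apply (sol_du _ _ _ _ _ _ _ _ Sol), cylinder_intro.
    - unfold B. apply Rabs_le.
      pose proof (Rle_abs (p r t)). pose proof (Rle_abs (- p r t)).
      rewrite Rabs_Ropp in *. lra. }
  assert (Hti : Rabs (u r t' - u r t) <= C * Rabs (t' - t)).
  { specialize (H2 t' HT ltac:(lra)).
    replace (u r t' - u r t) with
      ((u r t' - u r t - (t' - t) * f r t) + f r t * (t' - t)) by ring.
    eapply Rle_trans; [apply Rabs_triang |]. rewrite Rabs_mult. unfold C. lra. }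
  replace (u r' t' - u r t) with ((u r' t' - u r t') + (u r t' - u r t)) by ring.
  eapply Rle_lt_trans; [apply Rabs_triang |].
  assert ((B + C) * d <= eps).
  { apply Rle_trans with ((B + C) * (eps / (B + C))).
    - apply Rmult_le_compat_l; lra.
    - right. field. lra. }
  nra.
Qed.

(** Near a point of slope [1] the flux stays below its maximal value, which it
    takes at that point. *)
Lemma flux_critical F F1 k r1 r2 T u p q f : threshold_flux F F1 k ->
  flux_solution F r1 r2 T u p q f ->
  forall r t, r1 < r < r2 -> 0 <= t < T -> p r t = 1 -> q r t = 0.
Proof.
  intros HF Sol r t Hr Ht Hp.
  destruct (gradient_near _ _ _ _ _ _ _ _ Sol r t Hr Ht 1 ltac:(lra)) as [d [Hd H]].
  assert (Hmax : forall y, Rabs (y - r) < d -> F (p y t) <= F (p r t)).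
  { intros y Hy. rewrite Hp. apply (flux_le_max _ _ _ HF).
    destruct (H y t Hy) as [_ Hpy]; [| exact Ht |].
    - rewrite Rminus_diag, Rabs_R0. exact Hd.
    - lra. }
  pose proof (sol_dflux _ _ _ _ _ _ _ _ Sol r t (cylinder_intro _ _ _ _ _ Hr Ht)) as Hq.
  apply Rle_antisym.
  - apply (is_derive_nonpos _ _ _ d Hq Hd). intros y Hy. apply Hmax.
    apply Rabs_def1; lra.
  - apply (is_derive_nonneg _ _ _ d Hq Hd). intros y Hy. apply Hmax.
    apply Rabs_def1; lra.
Qed.

Lemma solution_dt_minus F r1 r2 T u p q f : flux_solution F r1 r2 T u p q f ->
  forall r s t a b, r1 < r < r2 -> r1 < s < r2 -> 0 <= t < T ->
  is_derive_within (time_interval T)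
    (fun t => u r t - u s t - (a + b * t)) t (f r t - f s t - b).
Proof.
  intros Sol r s t a b Hr Hs Ht.
  apply (is_derive_within_minus _ (fun t => u r t - u s t) (fun t => a + b * t)).
  - apply (is_derive_within_minus _ (u r) (u s));
    apply (sol_dt _ _ _ _ _ _ _ _ Sol); now apply cylinder_intro.
  - apply is_derive_within_linear.
Qed.
(** * Subcritical points stay subcritical *)

Lemma continuation (Q : R -> Prop) (a b : R) :
  Q a ->
  (forall t, a < t <= b -> (forall t', a <= t' < t -> Q t') -> Q t) ->
  (forall t, a <= t < b -> Q t ->
     exists d, 0 < d /\ forall t', t <= t' < t + d -> t' <= b -> Q t') ->
  forall t, a <= t <= b -> Q t.
Proof.
  intros Ha Hclosed Hopen t Ht.
  set (E := fun s => a <= s <= b /\ forall t', a <= t' <= s -> Q t').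
  destruct (completeness E) as [m [Hub Hlub]].
  - exists b. intros s [Hs _]. lra.
  - exists a. split; [lra |]. intros t' Ht'. now replace t' with a by lra.
  - assert (Ham : a <= m).
    { apply Hub. split; [lra |]. intros t' Ht'. now replace t' with a by lra. }
    assert (Hmb : m <= b) by (apply Hlub; intros s [Hs _]; lra).
    assert (Hbelow : forall t', a <= t' < m -> Q t').
    { intros t' Ht'. apply NNPP. intros HQ.
      apply (Rlt_irrefl m), Rle_lt_trans with t'; [| lra].
      apply Hlub. intros s [Hs HsQ]. apply Rnot_lt_le. intros Hlt.
      apply HQ, HsQ. lra. }
    assert (HQm : Q m).
    { destruct (Req_dec m a) as [-> | Hne]; [exact Ha |]. apply Hclosed; [lra | exact Hbelow]. }
    destruct (Req_dec m b) as [-> | Hne].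
    + destruct (Req_dec t b) as [-> | ]; [exact HQm | apply Hbelow; lra].
    + exfalso. destruct (Hopen m ltac:(lra) HQm) as [d [Hd Hd']].
      set (s := Rmin (m + d / 2) b).
      assert (Hs : m < s /\ s <= b /\ s < m + d).
      { unfold s. pose proof (Rmin_l (m + d / 2) b). pose proof (Rmin_r (m + d / 2) b).
        repeat split; try lra. apply Rmin_glb_lt; lra. }
      assert (s <= m); [| lra]. apply Hub. split; [lra |]. intros t' Ht'.
      destruct (Rlt_le_dec t' m); [apply Hbelow; lra | apply Hd'; lra].
Qed.

Lemma flux_inverse F F1 k : threshold_flux F F1 k ->
  exists beta : R -> R,
    (forall y, 0 <= y <= F 1 -> 0 <= beta y <= 1 /\ F (beta y) = y) /\
    forall y, continuous beta y.
Proof.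
  intros HF. set (M := F 1).
  pose proof (flux_max_pos _ _ _ HF) as HM. fold M in HM.
  set (clamp := fun y => Rmax 0 (Rmin y M)).
  assert (Hclamp : forall y, 0 <= clamp y <= M).
  { intros y. unfold clamp. split; [apply Rmax_l |].
    apply Rmax_lub; [lra | apply Rmin_r]. }
  assert (Hid : forall y, 0 <= y <= M -> clamp y = y).
  { intros y Hy. unfold clamp. rewrite Rmin_left, Rmax_right; lra. }
  assert (Hex : forall y, exists x, 0 <= x <= 1 /\ F x = clamp y).
  { intros y. destruct (IVT_gen F 0 1 (clamp y)) as [x [Hx Hx']].
    - intros x. apply derivable_continuous_pt. exists (F1 x).
      apply is_derive_Reals, (flux_derive _ _ _ HF).
    - specialize (Hclamp y). fold M. rewrite (flux_0 _ _ _ HF).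
      rewrite Rmin_left, Rmax_right; lra.
    - exists x. rewrite Rmin_left, Rmax_right in Hx by lra. now split. }
  set (beta := fun y => proj1_sig (constructive_indefinite_description _ (Hex y))).
  assert (Hbeta : forall y, 0 <= beta y <= 1 /\ F (beta y) = clamp y).
  { intros y. exact (proj2_sig (constructive_indefinite_description _ (Hex y))). }
  exists beta. split.
  - intros y Hy. destruct (Hbeta y) as [Hb Hb']. split; [exact Hb |].
    now rewrite Hb', Hid.
  - intros y. apply continuity_pt_filterlim. intros eps Heps.
    destruct (Hbeta y) as [Hx HFx]. set (x := beta y) in *.
    assert (Hup : exists d, 0 < d /\
      forall z, clamp z < clamp y + d -> beta z < x + eps).
    { destruct (Rle_dec (x + eps) 1) as [Hle | Hgt].
      - exists (F (x + eps) - F x). split.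
        + pose proof (flux_incr _ _ _ HF x (x + eps)). lra.
        + intros z Hz. destruct (Hbeta z) as [Hz1 Hz2].
          apply (flux_incr_inv _ _ _ HF); lra.
      - exists 1. split; [lra |]. intros z _. destruct (Hbeta z). lra. }
    assert (Hdown : exists d, 0 < d /\
      forall z, clamp y - d < clamp z -> x - eps < beta z).
    { destruct (Rle_dec 0 (x - eps)) as [Hle | Hgt].
      - exists (F x - F (x - eps)). split.
        + pose proof (flux_incr _ _ _ HF (x - eps) x). lra.
        + intros z Hz. destruct (Hbeta z) as [Hz1 Hz2].
          apply (flux_incr_inv _ _ _ HF); lra.
      - exists 1. split; [lra |]. intros z _. destruct (Hbeta z). lra. }
    destruct Hup as [d1 [Hd1 Hup]]. destruct Hdown as [d2 [Hd2 Hdown]].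
    exists (Rmin d1 d2). split; [now apply Rmin_pos |].
    intros z [_ Hz]. unfold dist in *. simpl in *. unfold Rdist in *.
    pose proof (Rmin_l d1 d2). pose proof (Rmin_r d1 d2).
    apply Rabs_def2 in Hz.
    assert (Hlip : clamp y - d2 < clamp z < clamp y + d1).
    { unfold clamp, Rmax, Rmin.
      destruct (Rle_dec z M), (Rle_dec y M), (Rle_dec 0 z), (Rle_dec 0 y),
        (Rle_dec 0 M); lra. }
    specialize (Hup z ltac:(lra)). specialize (Hdown z ltac:(lra)).
    apply Rabs_def1; lra.
Qed.

(** Barriers are prescribed through their flux [V]; the slope [w] comes from the
    inverse of the rising branch of [F], and comparison needs its primitive. *)
Lemma barrier_gradient F F1 k : threshold_flux F F1 k ->
  forall V : R -> R, (forall x, continuous V x) ->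
  exists w W : R -> R, (forall x, is_derive W x (w x)) /\
    forall x, 0 <= V x <= F 1 -> 0 <= w x <= 1 /\ F (w x) = V x.
Proof.
  intros HF V HV. destruct (flux_inverse _ _ _ HF) as [beta [Hinv Hcont]].
  set (w := fun x => beta (V x)).
  assert (Hw : forall x, continuous w x).
  { intros x. apply (continuous_comp V beta); [apply HV | apply Hcont]. }
  exists w, (RInt w 0). split.
  - intros x. apply is_derive_RInt with 0; [| apply Hw].
    apply filter_forall. intros y. apply (RInt_correct (V := R_CompleteNormedModule) w),
      (ex_RInt_continuous (V := R_CompleteNormedModule) w).
    intros z _. apply Hw.
  - intros x Hx. now apply Hinv.
Qed.

(** If [u(r) - u(s)] exceeds [G(r) - G(s)] somewhere, a maximal excess is
    attained at two distinct interior points: at the end points of the interval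
    [u] is less steep than [G], so moving away from them increases the excess. *)
Lemma two_point_maximum F r1 r2 T u p q f : flux_solution F r1 r2 T u p q f ->
  forall (G g : R -> R -> R) (alpha c beta t1 t2 : R),
  0 <= c -> 0 <= t1 -> t2 < T -> r1 < alpha -> beta < r2 ->
  (forall x t, is_derive (fun y => G y t) x (g x t)) ->
  (forall x t, continuity_2d_pt G x t) ->
  (forall t, t1 <= t <= t2 -> alpha + c * t < beta ->
     p (alpha + c * t) t < g (alpha + c * t) t /\ p beta t < g beta t) ->
  forall s0 r0 t0, trapezoid alpha c beta t1 t2 s0 r0 t0 ->
  0 < u r0 t0 - u s0 t0 - (G r0 t0 - G s0 t0) ->
  exists s r t, t1 <= t <= t2 /\ alpha + c * t < s /\ s < r /\ r < beta /\
    p s t = g s t /\ p r t = g r t /\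
    0 < u r t - u s t - (G r t - G s t) /\
    forall s' r' t', trapezoid alpha c beta t1 t2 s' r' t' ->
      u r' t' - u s' t' - (G r' t' - G s' t') <= u r t - u s t - (G r t - G s t).
Proof.
  intros Sol G g alpha c beta t1 t2 Hc Ht1 Ht2 Halpha Hbeta HG HGc Hends
    s0 r0 t0 H0 HZ0.
  set (Z := fun s r t => u r t - u s t - (G r t - G s t)).
  assert (Hin : forall s r t, trapezoid alpha c beta t1 t2 s r t ->
    0 <= t < T /\ r1 < s < r2 /\ r1 < r < r2).
  { intros s r t [Ht [[Hs Hsr] Hr]].
    assert (0 <= c * t) by (apply Rmult_le_pos; lra). lra. }
  destruct (exists_max_trapezoid alpha c beta t1 t2 Z s0 r0 t0 Hc H0)
    as [s [r [t [HK Hmax]]]].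
  - intros s r t HK eps Heps. destruct (Hin _ _ _ HK) as [Ht [Hs Hr]].
    assert (He : 0 < eps / 4) by lra.
    destruct (solution_continuous _ _ _ _ _ _ _ _ Sol s t Hs Ht _ He) as [d1 [Hd1 H1]].
    destruct (solution_continuous _ _ _ _ _ _ _ _ Sol r t Hr Ht _ He) as [d2 [Hd2 H2]].
    destruct (HGc s t (mkposreal _ He)) as [d3 H3].
    destruct (HGc r t (mkposreal _ He)) as [d4 H4].
    pose proof (cond_pos d3). pose proof (cond_pos d4). simpl in H3, H4.
    exists (Rmin (Rmin d1 d2) (Rmin d3 d4)).
    split; [repeat apply Rmin_pos; assumption |].
    intros s' r' t' HK' Hs' Hr' Ht'. destruct (Hin _ _ _ HK') as [HT' _].
    pose proof (Rmin_l (Rmin d1 d2) (Rmin d3 d4)).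
    pose proof (Rmin_r (Rmin d1 d2) (Rmin d3 d4)).
    pose proof (Rmin_l d1 d2). pose proof (Rmin_r d1 d2).
    pose proof (Rmin_l d3 d4). pose proof (Rmin_r d3 d4).
    specialize (H1 s' t' ltac:(lra) ltac:(lra) HT').
    specialize (H2 r' t' ltac:(lra) ltac:(lra) HT').
    specialize (H3 s' t' ltac:(lra) ltac:(lra)).
    specialize (H4 r' t' ltac:(lra) ltac:(lra)).
    apply Rabs_def2 in H1. apply Rabs_def2 in H2.
    apply Rabs_def2 in H3. apply Rabs_def2 in H4.
    unfold Z. apply Rabs_def1; lra.
  - destruct (Hin _ _ _ HK) as [HtT [Hs Hr]].
    destruct HK as [Ht [[Has Hsr] Hrb]].
    assert (HZ : 0 < Z s r t).
    { eapply Rlt_le_trans; [exact HZ0 |]. now apply Hmax. }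
    assert (Hlt : s < r).
    { destruct Hsr as [H | H]; [exact H |]. subst r. unfold Z in HZ. lra. }
    assert (Hup : forall y, s <= y <= beta -> u y t - G y t <= u r t - G r t).
    { intros y Hy. specialize (Hmax s y t). unfold Z, trapezoid in Hmax.
      assert (u y t - u s t - (G y t - G s t) <= u r t - u s t - (G r t - G s t)).
      { apply Hmax. repeat split; lra. }
      lra. }
    assert (Hdown : forall y, alpha + c * t <= y <= r ->
      u s t - G s t <= u y t - G y t).
    { intros y Hy. specialize (Hmax y r t). unfold Z, trapezoid in Hmax.
      assert (u r t - u y t - (G r t - G y t) <= u r t - u s t - (G r t - G s t)).
      { apply Hmax. repeat split; lra. }
      lra. }
    assert (Hdr : is_derive (fun y => u y t - G y t) r (p r t - g r t)).
    { apply (is_derive_minus (fun y => u y t) (fun y => G y t)); [| apply HG].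
      apply (sol_du _ _ _ _ _ _ _ _ Sol). now apply cylinder_intro. }
    assert (Hds : is_derive (fun y => G y t - u y t) s (g s t - p s t)).
    { apply (is_derive_minus (fun y => G y t) (fun y => u y t)); [apply HG |].
      apply (sol_du _ _ _ _ _ _ _ _ Sol). now apply cylinder_intro. }
    destruct (Hends t Ht ltac:(lra)) as [Hea Heb].
    assert (Hpr : 0 <= p r t - g r t).
    { apply (is_derive_nonneg _ _ _ (r - s) Hdr); [lra |].
      intros y Hy. apply Hup. lra. }
    assert (Hps : g s t - p s t <= 0).
    { apply (is_derive_nonpos _ _ _ (r - s) Hds); [lra |].
      intros y Hy. specialize (Hdown y ltac:(lra)). lra. }
    assert (Hrb' : r < beta).
    { destruct Hrb as [H | H]; [exact H |]. subst r. lra. }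
    assert (Has' : alpha + c * t < s).
    { destruct Has as [H | H]; [exact H |]. subst s. lra. }
    assert (Hpr' : p r t - g r t <= 0).
    { apply (is_derive_nonpos _ _ _ (beta - r) Hdr); [lra |].
      intros y Hy. apply Hup. lra. }
    assert (Hps' : 0 <= g s t - p s t).
    { apply (is_derive_nonneg _ _ _ (s - (alpha + c * t)) Hds); [lra |].
      intros y Hy. specialize (Hdown y ltac:(lra)). lra. }
    exists s, r, t. repeat split; try lra; assumption.
Qed.

(** A barrier flux [V] that reaches [F 1] with nonzero slope cannot be touched
    from below at that point, since a flux equal to [F 1] has slope zero there.
    The solution is compared with [V] only on one side of [x], the one where
    [V] is smaller: [side] is [1] for the left and [-1] for the right. *)
Lemma barrier_edge F F1 k r1 r2 T u p q f :
  threshold_flux F F1 k -> flux_solution F r1 r2 T u p q f ->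
  forall x t slope V side eta, r1 < x < r2 -> 0 <= t < T ->
  is_derive V x slope -> V x = F 1 ->
  0 < eta -> (side = 1 \/ side = -1) -> 0 < side * slope ->
  (forall y, x - eta < y < x + eta -> 0 < side * (x - y) -> 0 < p y t ->
     F (p y t) <= V y) ->
  p x t <> 1.
Proof.
  intros HF Sol x t slope V side eta Hx Ht HV HVx Heta Hside Hslope Hle Heq.
  pose proof (flux_critical _ _ _ _ _ _ _ _ _ _ HF Sol x t Hx Ht Heq) as Hq.
  destruct (gradient_near _ _ _ _ _ _ _ _ Sol x t Hx Ht 1 ltac:(lra)) as [d [Hd Hnear]].
  assert (Hgap : is_derive (fun y => F (p y t) - V y) x (0 - slope)).
  { rewrite <- Hq. apply (is_derive_minus (fun y => F (p y t)) V); [| exact HV].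
    apply (sol_dflux _ _ _ _ _ _ _ _ Sol). now apply cylinder_intro. }
  pose proof (Rmin_l d eta). pose proof (Rmin_r d eta).
  assert (Hm : 0 < Rmin d eta) by (now apply Rmin_pos).
  assert (Hmax : forall y, Rabs (y - x) < Rmin d eta -> 0 < side * (x - y) ->
    F (p y t) - V y <= F (p x t) - V x).
  { intros y Hy Hs. destruct (Hnear y t ltac:(lra)) as [_ Hpy]; [| exact Ht |].
    - rewrite Rminus_diag, Rabs_R0. exact Hd.
    - apply Rabs_def2 in Hy.
      specialize (Hle y ltac:(lra) Hs ltac:(lra)). rewrite Heq, HVx. lra. }
  destruct Hside as [-> | ->].
  - assert (0 <= 0 - slope); [| lra].
    apply (is_derive_nonneg _ _ _ _ Hgap Hm). intros y Hy.
    apply Hmax; [apply Rabs_def1; lra | lra].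
  - assert (0 - slope <= 0); [| lra].
    apply (is_derive_nonpos _ _ _ _ Hgap Hm). intros y Hy.
    apply Hmax; [apply Rabs_def1; lra | lra].
Qed.

(** Comparison with the stationary barrier of flux [V = F 1 - kap (rho^2 - x^2)],
    [x = r - r0], over a short time. At the ends the solution is strictly below
    the barrier by [barrier_edge] and remains so for a while; inside, a positive
    two-point excess at [(s,r,t)] contradicts the equation because
    [V' + V / r] is decreasing. The latter holds thanks to the term [F 1 / r]
    once [kap] is small. *)
Lemma barrier_step F F1 k r1 r2 T u p q f r0 rho kap (w W : R -> R) :
  threshold_flux F F1 k -> flux_solution F r1 r2 T u p q f ->
  0 < rho -> 0 < kap -> r1 < r0 - rho -> r0 + rho < r2 ->
  kap * rho ^ 2 < F 1 -> 3 * kap * r2 ^ 2 <= F 1 ->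
  (forall x, is_derive W x (w x)) ->
  (forall x, r0 - rho <= x <= r0 + rho ->
     0 <= w x <= 1 /\ F (w x) = F 1 - kap * (rho ^ 2 - (x - r0) ^ 2)) ->
  forall tau, 0 <= tau < T ->
  (forall x, r0 - rho <= x <= r0 + rho -> p x tau <= w x) ->
  exists d, 0 < d /\ forall t, tau <= t < tau + d -> t < T ->
    forall x, r0 - rho <= x <= r0 + rho -> p x t <= w x.
Proof.
  intros HF Sol Hrho Hkap Hlow Hup Hkap1 Hkap2 HW Hw tau Htau HQ.
  pose proof (sol_r1 _ _ _ _ _ _ _ _ Sol) as Hr1.
  set (V := fun x => F 1 - kap * (rho ^ 2 - (x - r0) ^ 2)).
  assert (HV : forall x, is_derive V x (2 * kap * (x - r0))).
  { intros x. unfold V. auto_derive; [exact I | ring]. }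
  assert (Hkr : 0 < kap * rho) by (apply Rmult_lt_0_compat; lra).
  assert (Hone : forall x, (x = r0 - rho \/ x = r0 + rho) -> w x = 1).
  { intros x Hx. destruct (Hw x) as [Hw1 Hw2]; [lra |].
    apply Rle_antisym; [lra |]. apply Rnot_lt_le. intros Hlt.
    pose proof (flux_incr _ _ _ HF (w x) 1 ltac:(lra) Hlt ltac:(lra)).
    rewrite Hw2 in H. replace ((x - r0) ^ 2) with (rho ^ 2) in H
      by (destruct Hx; subst; ring). lra. }
  assert (Hinside : forall x, r0 - rho < x < r0 + rho -> 0 < w x < 1).
  { intros x Hx. destruct (Hw x) as [Hw1 Hw2]; [lra |].
    assert (Hsq : 0 < rho ^ 2 - (x - r0) ^ 2).
    { replace (rho ^ 2 - (x - r0) ^ 2) with ((rho - (x - r0)) * (rho + (x - r0))) by ring.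
      apply Rmult_lt_0_compat; lra. }
    assert (kap * (rho ^ 2 - (x - r0) ^ 2) <= kap * rho ^ 2).
    { apply Rmult_le_compat_l; [lra |]. pose proof (pow2_ge_0 (x - r0)). lra. }
    assert (0 < kap * (rho ^ 2 - (x - r0) ^ 2)) by (apply Rmult_lt_0_compat; lra).
    pose proof (flux_0 _ _ _ HF) as F0.
    split; apply Rnot_le_lt; intros Hle.
    - replace (w x) with 0 in Hw2 by lra. lra.
    - replace (w x) with 1 in Hw2 by lra. lra. }
  assert (Hflux : forall x, r0 - rho <= x <= r0 + rho -> 0 < p x tau ->
    F (p x tau) <= V x).
  { intros x Hx Hp. destruct (Hw x Hx) as [Hw1 Hw2]. unfold V. rewrite <- Hw2.
    destruct (HQ x Hx) as [Hlt | ->]; [| lra].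
    left. apply (flux_incr _ _ _ HF); lra. }
  assert (Hedge : p (r0 - rho) tau < 1 /\ p (r0 + rho) tau < 1).
  { pose proof (HQ (r0 - rho) ltac:(lra)) as He1.
    pose proof (HQ (r0 + rho) ltac:(lra)) as He2.
    rewrite Hone in He1, He2 by lra.
    assert (HVe : V (r0 - rho) = F 1 /\ V (r0 + rho) = F 1)
      by (split; unfold V; ring).
    destruct HVe as [HVe1 HVe2].
    split; apply Rnot_le_lt; intros Hge.
    - apply (barrier_edge _ _ _ _ _ _ _ _ _ _ HF Sol (r0 - rho) tau _ V (-1) rho
        ltac:(lra) Htau (HV _) HVe1 Hrho (or_intror eq_refl)); [lra | | lra].
      intros y Hy Hy'. apply Hflux. lra.
    - apply (barrier_edge _ _ _ _ _ _ _ _ _ _ HF Sol (r0 + rho) tau _ V 1 rho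
        ltac:(lra) Htau (HV _) HVe2 Hrho (or_introl eq_refl)); [lra | | lra].
      intros y Hy Hy'. apply Hflux. lra. }
  assert (Hstay : exists d, 0 < d /\ tau + d < T /\
    forall t, tau <= t <= tau + d -> p (r0 - rho) t < 1 /\ p (r0 + rho) t < 1).
  { destruct (gradient_near _ _ _ _ _ _ _ _ Sol (r0 - rho) tau ltac:(lra) Htau
      (1 - p (r0 - rho) tau) ltac:(lra)) as [d1 [Hd1 H1]].
    destruct (gradient_near _ _ _ _ _ _ _ _ Sol (r0 + rho) tau ltac:(lra) Htau
      (1 - p (r0 + rho) tau) ltac:(lra)) as [d2 [Hd2 H2]].
    set (d := Rmin (Rmin d1 d2) (T - tau) / 2).
    assert (Hd : 0 < d /\ d < d1 /\ d < d2 /\ d < T - tau).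
    { unfold d. pose proof (Rmin_l (Rmin d1 d2) (T - tau)).
      pose proof (Rmin_r (Rmin d1 d2) (T - tau)).
      pose proof (Rmin_l d1 d2). pose proof (Rmin_r d1 d2).
      assert (0 < Rmin (Rmin d1 d2) (T - tau)) by (repeat apply Rmin_pos; lra). lra. }
    exists d. split; [lra | split; [lra |]]. intros t Ht.
    assert (Rabs (t - tau) <= d) by (apply Rabs_le; lra). split.
    - destruct (H1 (r0 - rho) t) as [_ Hp]; try lra.
      rewrite Rminus_diag, Rabs_R0; lra.
    - destruct (H2 (r0 + rho) t) as [_ Hp]; try lra.
      rewrite Rminus_diag, Rabs_R0; lra. }
  destruct Hstay as [d [Hd [HdT Hstay]]].
  exists d. split; [exact Hd |]. intros t' Ht' HT' x Hx.
  apply Rnot_lt_le. intros Hbad.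
  assert (Hgap : forall y t, r0 - rho <= y <= r0 + rho -> 0 <= t < T ->
    is_derive (fun y => u y t - W y) y (p y t - w y)).
  { intros y t Hy Ht. apply (is_derive_minus (fun y => u y t) W); [| apply HW].
    apply (sol_du _ _ _ _ _ _ _ _ Sol), cylinder_intro; lra. }
  assert (Hxin : r0 - rho < x < r0 + rho).
  { destruct (Hstay t' ltac:(lra)) as [Hs1 Hs2].
    split; apply Rnot_le_lt; intros Hle.
    - replace x with (r0 - rho) in Hbad by lra. rewrite Hone in Hbad; [lra | now left].
    - replace x with (r0 + rho) in Hbad by lra. rewrite Hone in Hbad; [lra | now right]. }
  assert (Hpos : exists y, x <= y <= r0 + rho /\ 0 < u y t' - u x t' - (W y - W x)).
  { apply NNPP. intros Hno.
    assert (p x t' - w x <= 0); [| lra].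
    apply (is_derive_nonpos _ _ _ (r0 + rho - x) (Hgap x t' ltac:(lra) ltac:(lra)));
      [lra |].
    intros y Hy. apply Rnot_lt_le. intros Hlt. apply Hno. exists y. lra. }
  destruct Hpos as [y0 [Hy0 HZ0]].
  destruct (two_point_maximum _ _ _ _ _ _ _ _ Sol (fun y _ => W y) (fun y _ => w y)
    (r0 - rho) 0 (r0 + rho) tau (tau + d)) with (s0 := x) (r0 := y0) (t0 := t')
    as [s [r [t [Ht [Hs [Hsr [Hr [Hps [Hpr [HZ Hmax]]]]]]]]]]; try lra.
  - intros y _. apply HW.
  - intros y t. apply (continuity_1d_2d_pt_comp W (fun y _ => y));
      [| apply continuity_2d_pt_id1].
    apply derivable_continuous_pt. exists (w y). apply is_derive_Reals, HW.
  - intros t Ht _. rewrite Rmult_0_l, Rplus_0_r, !Hone by lra.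
    apply Hstay. lra.
  - unfold trapezoid. repeat split; lra.
  - rewrite Rmult_0_l, Rplus_0_r in Hs.
    assert (HtT : 0 <= t < T) by lra.
    assert (Htt : tau < t).
    { apply Rnot_le_lt. intros Hle. replace t with tau in * by lra.
      destruct (mean_value (fun y => u y tau - W y) (fun y => p y tau - w y) s r Hsr)
        as [c [Hc Hc']].
      - intros y Hy. apply Hgap; lra.
      - specialize (HQ c ltac:(lra)). nra. }
    assert (Htime : 0 <= f r t - f s t - 0).
    { apply (is_derive_within_nonneg T _ t _ (t - tau)
        (solution_dt_minus _ _ _ _ _ _ _ _ Sol r s t (W r - W s) 0
          ltac:(lra) ltac:(lra) HtT)); [lra | lra |].
      intros t'' Ht'' _. specialize (Hmax s r t'').
      enough (u r t'' - u s t'' - (W r - W s) <= u r t - u s t - (W r - W s)) by lra.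
      apply Hmax. unfold trapezoid. repeat split; lra. }
    assert (Hcyl : forall y, r0 - rho < y < r0 + rho -> cylinder r1 r2 T (y, t)).
    { intros y Hy. apply cylinder_intro; lra. }
    assert (Hnear : forall y, r0 - rho < y < r0 + rho -> p y t = w y ->
      exists eta, 0 < eta /\ y + eta <= r0 + rho /\
        forall z, y < z < y + eta -> 0 < p z t < 1).
    { intros y Hy Hpy. pose proof (Hinside y Hy).
      destruct (gradient_near _ _ _ _ _ _ _ _ Sol y t ltac:(lra) HtT
        (Rmin (w y) (1 - w y))) as [e [He Hne]]; [apply Rmin_pos; lra |].
      pose proof (Rmin_l (w y) (1 - w y)). pose proof (Rmin_r (w y) (1 - w y)).
      pose proof (Rmin_l e (r0 + rho - y)). pose proof (Rmin_r e (r0 + rho - y)).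
      exists (Rmin e (r0 + rho - y)). split; [apply Rmin_pos; lra |].
      split; [lra |]. intros z Hz. destruct (Hne z t) as [_ Hp].
      - apply Rabs_def1; lra.
      - rewrite Rminus_diag, Rabs_R0. exact He.
      - exact HtT.
      - rewrite Hpy in Hp. lra. }
    assert (Hdr : q r t <= 2 * kap * (r - r0)).
    { destruct (Hnear r ltac:(lra) Hpr) as [eta [Heta [Hreta Hp]]].
      enough (q r t - 2 * kap * (r - r0) <= 0) by lra.
      apply (second_order_test (fun y => u y t - W y) (fun y => p y t - w y)
        (fun y => F (p y t) - V y) r _ eta Heta).
      - intros y Hy. apply Hgap; lra.
      - intros y Hy. specialize (Hmax s y t). cbv beta in Hmax.
        enough (u y t - u s t - (W y - W s) <= u r t - u s t - (W r - W s)) by lra.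
        apply Hmax. unfold trapezoid. repeat split; lra.
      - intros y Hy Hpos. destruct (Hw y ltac:(lra)) as [Hw1 Hw2].
        specialize (Hp y Hy). fold (V y) in Hw2.
        pose proof (flux_incr_inv _ _ _ HF (w y) (p y t)). lra.
      - cbv beta. rewrite Hpr. destruct (Hw r ltac:(lra)) as [_ ->]. unfold V. ring.
      - apply (is_derive_minus (fun y => F (p y t)) V); [| apply HV].
        apply (sol_dflux _ _ _ _ _ _ _ _ Sol), Hcyl. lra. }
    assert (Hds : 2 * kap * (s - r0) <= q s t).
    { destruct (Hnear s ltac:(lra) Hps) as [eta [Heta [Hseta Hp]]].
      enough (2 * kap * (s - r0) - q s t <= 0) by lra.
      pose proof (Rmin_l eta (r - s)). pose proof (Rmin_r eta (r - s)).
      apply (second_order_test (fun y => W y - u y t) (fun y => w y - p y t)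
        (fun y => V y - F (p y t)) s _ (Rmin eta (r - s))).
      - apply Rmin_pos; lra.
      - intros y Hy. apply (is_derive_minus W (fun y => u y t)); [apply HW |].
        apply (sol_du _ _ _ _ _ _ _ _ Sol), Hcyl. lra.
      - intros y Hy. specialize (Hmax y r t). cbv beta in Hmax.
        enough (u r t - u y t - (W r - W y) <= u r t - u s t - (W r - W s)) by lra.
        apply Hmax. unfold trapezoid. repeat split; lra.
      - intros y Hy Hpos. destruct (Hw y ltac:(lra)) as [Hw1 Hw2].
        specialize (Hp y ltac:(lra)). fold (V y) in Hw2.
        pose proof (flux_incr_inv _ _ _ HF (p y t) (w y)). lra.
      - cbv beta. rewrite Hps. destruct (Hw s ltac:(lra)) as [_ ->]. unfold V. ring.
      - apply (is_derive_minus V (fun y => F (p y t))); [apply HV |].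
        apply (sol_dflux _ _ _ _ _ _ _ _ Sol), Hcyl. lra. }
    rewrite (sol_eq _ _ _ _ _ _ _ _ Sol r t), (sol_eq _ _ _ _ _ _ _ _ Sol s t),
      Hpr, Hps in Htime by (apply Hcyl; lra).
    destruct (Hw r ltac:(lra)) as [_ HFr]. destruct (Hw s ltac:(lra)) as [_ HFs].
    rewrite HFr, HFs in Htime.
    (* V y / y = N / y + kap y - 2 kap r0 *)
    set (N := F 1 - kap * rho ^ 2 + kap * r0 ^ 2).
    assert (HN : F 1 < N).
    { unfold N. assert (kap * rho ^ 2 < kap * r0 ^ 2); [| lra].
      apply Rmult_lt_compat_l; [lra |]. rewrite <- !Rsqr_pow2.
      apply Rsqr_incrst_1; lra. }
    assert (Hrs : r * s < r2 ^ 2).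
    { replace (r2 ^ 2) with (r2 * r2) by ring. apply Rmult_le_0_lt_compat; lra. }
    assert (H3 : 3 * kap < N / (r * s)).
    { apply (Rmult_lt_reg_r (r * s)); [apply Rmult_lt_0_compat; lra |].
      replace (N / (r * s) * (r * s)) with N by (field; lra).
      assert (3 * kap * (r * s) < 3 * kap * r2 ^ 2) by (apply Rmult_lt_compat_l; lra).
      lra. }
    replace ((F 1 - kap * (rho ^ 2 - (r - r0) ^ 2)) / r)
      with (N / r + kap * r - 2 * kap * r0) in Htime by (unfold N; field; lra).
    replace ((F 1 - kap * (rho ^ 2 - (s - r0) ^ 2)) / s)
      with (N / s + kap * s - 2 * kap * r0) in Htime by (unfold N; field; lra).
    assert (HNs : N / s = N / r + (r - s) * (N / (r * s))) by (field; lra).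
    assert ((r - s) * (3 * kap) < (r - s) * (N / (r * s)))
      by (apply Rmult_lt_compat_l; lra).
    lra.
Qed.

(** The barrier of [barrier_step] is started above the slope [p] at time [t];
    its own slope is below [1] at the centre [r]. *)
Lemma subcritical_persists F F1 k r1 r2 T u p q f :
  threshold_flux F F1 k -> flux_solution F r1 r2 T u p q f ->
  forall r t t', r1 < r < r2 -> 0 <= t <= t' -> t' < T ->
  p r t < 1 -> p r t' < 1.
Proof.
  intros HF Sol r0 t1 t2 Hr Ht1 Ht2 Hp.
  pose proof (sol_r1 _ _ _ _ _ _ _ _ Sol) as Hr1.
  (* m lies between p and 1, and is positive so that F rises from m to 1 *)
  set (m := Rmax (1 / 2) ((1 + p r0 t1) / 2)).
  assert (Hm : 0 < m < 1 /\ p r0 t1 < m).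
  { unfold m. pose proof (Rmax_l (1/2) ((1 + p r0 t1) / 2)).
    pose proof (Rmax_r (1/2) ((1 + p r0 t1) / 2)).
    assert (Rmax (1 / 2) ((1 + p r0 t1) / 2) < 1) by (apply Rmax_lub_lt; lra). lra. }
  destruct (gradient_near _ _ _ _ _ _ _ _ Sol r0 t1 Hr ltac:(lra) (m - p r0 t1)
    ltac:(lra)) as [d [Hd Hnear]].
  set (rho := d / 2).
  assert (Hrho : 0 < rho < d) by (unfold rho; lra).
  assert (Hloc : forall x, r0 - rho <= x <= r0 + rho -> r1 < x < r2 /\ p x t1 < m).
  { intros x Hx. destruct (Hnear x t1) as [Hx1 Hx2].
    - apply Rabs_def1; lra.
    - rewrite Rminus_diag, Rabs_R0. exact Hd.
    - lra.
    - lra. }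
  pose proof (Hloc (r0 - rho) ltac:(lra)) as [Hlow _].
  pose proof (Hloc (r0 + rho) ltac:(lra)) as [Hup _].
  pose proof (flux_incr _ _ _ HF m 1 ltac:(lra) ltac:(lra) ltac:(lra)) as HFm.
  pose proof (flux_incr _ _ _ HF 0 m ltac:(lra) ltac:(lra) ltac:(lra)) as HFm0.
  rewrite (flux_0 _ _ _ HF) in HFm0.
  assert (Hrho2 : 0 < rho ^ 2) by (apply pow_lt; lra).
  assert (Hr22 : 0 < r2 ^ 2) by (apply pow_lt; lra).
  set (kap := Rmin ((F 1 - F m) / rho ^ 2) (F 1 / (3 * r2 ^ 2))).
  assert (Hkap : 0 < kap) by (apply Rmin_pos; apply Rdiv_lt_0_compat; lra).
  assert (Hkap1 : kap * rho ^ 2 <= F 1 - F m).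
  { apply Rle_trans with ((F 1 - F m) / rho ^ 2 * rho ^ 2).
    - apply Rmult_le_compat_r; [lra | apply Rmin_l].
    - right. field. lra. }
  assert (Hkap2 : 3 * kap * r2 ^ 2 <= F 1).
  { apply Rle_trans with (3 * (F 1 / (3 * r2 ^ 2)) * r2 ^ 2).
    - apply Rmult_le_compat_r; [lra |]. apply Rmult_le_compat_l; [lra | apply Rmin_r].
    - right. field. lra. }
  set (V := fun x => F 1 - kap * (rho ^ 2 - (x - r0) ^ 2)).
  destruct (barrier_gradient _ _ _ HF V) as [w [W [HW Hw]]].
  { intros x. apply (ex_derive_continuous V). unfold V. auto_derive. exact I. }
  assert (HV : forall x, r0 - rho <= x <= r0 + rho -> F m <= V x <= F 1).
  { intros x Hx.
    assert (Hsq : 0 <= rho ^ 2 - (x - r0) ^ 2 <= rho ^ 2).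
    { pose proof (pow2_ge_0 (x - r0)). split; [| lra].
      replace (rho ^ 2 - (x - r0) ^ 2) with ((rho - (x - r0)) * (rho + (x - r0))) by ring.
      apply Rmult_le_pos; lra. }
    unfold V. split; [| nra].
    assert (kap * (rho ^ 2 - (x - r0) ^ 2) <= kap * rho ^ 2)
      by (apply Rmult_le_compat_l; lra). lra. }
  assert (Hw' : forall x, r0 - rho <= x <= r0 + rho -> 0 <= w x <= 1 /\ F (w x) = V x).
  { intros x Hx. apply Hw. pose proof (HV x Hx). lra. }
  assert (HQ : forall t, t1 <= t <= t2 ->
    forall x, r0 - rho <= x <= r0 + rho -> p x t <= w x).
  { apply (continuation (fun t => forall x, r0 - rho <= x <= r0 + rho -> p x t <= w x)).
    - intros x Hx. destruct (Hloc x Hx) as [_ Hpx]. destruct (Hw' x Hx) as [Hw1 Hw2].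
      apply Rnot_lt_le. intros Hlt.
      pose proof (flux_incr _ _ _ HF (w x) m ltac:(lra) ltac:(lra) ltac:(lra)).
      pose proof (HV x Hx). lra.
    - intros t Ht Hbefore x Hx. apply Rnot_lt_le. intros Hlt.
      destruct (Hloc x Hx) as [Hxin _].
      destruct (gradient_near _ _ _ _ _ _ _ _ Sol x t Hxin ltac:(lra) (p x t - w x)
        ltac:(lra)) as [e [He Hne]].
      set (s := Rmax t1 (t - e / 2)).
      assert (Hs : t1 <= s < t /\ t - e < s).
      { unfold s. pose proof (Rmax_l t1 (t - e / 2)). pose proof (Rmax_r t1 (t - e / 2)).
        assert (Rmax t1 (t - e / 2) < t) by (apply Rmax_lub_lt; lra). lra. }
      destruct (Hne x s) as [_ Hpx].
      + rewrite Rminus_diag, Rabs_R0. exact He.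
      + apply Rabs_def1; lra.
      + lra.
      + specialize (Hbefore s ltac:(lra) x Hx). lra.
    - intros t Ht HQt.
      destruct (barrier_step F F1 k r1 r2 T u p q f r0 rho kap w W HF Sol
        ltac:(lra) Hkap ltac:(lra) ltac:(lra) ltac:(lra) Hkap2 HW Hw' t ltac:(lra) HQt)
        as [e [He Hstep]].
      exists e. split; [exact He |]. intros t' Ht' Ht2'. apply Hstep; lra. }
  apply Rle_lt_trans with (w r0); [apply HQ; lra |].
  destruct (Hw' r0 ltac:(lra)) as [Hw1 Hw2].
  apply Rnot_le_lt. intros Hle. replace (w r0) with 1 in Hw2 by lra.
  unfold V in Hw2. rewrite Rminus_diag in Hw2. nra.
Qed.
(** * The subcritical region expands *)

Definition ramp (n : nat) (x : R) : R := Rmax x 0 ^ n.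

Lemma ramp_left n x : x <= 0 -> ramp (S n) x = 0.
Proof. intros Hx. unfold ramp. rewrite Rmax_right by lra. simpl. ring. Qed.

Lemma ramp_right n x : 0 <= x -> ramp n x = x ^ n.
Proof. intros Hx. unfold ramp. now rewrite Rmax_left by lra. Qed.

Lemma is_derive_ramp n x :
  is_derive (ramp (S (S n))) x (INR (S (S n)) * ramp (S n) x).
Proof.
  induction n as [| n IH].
  - apply is_derive_Reals. intros eps Heps. exists (mkposreal eps Heps). simpl.
    intros h Hh0 Hh. unfold ramp.
    assert (Hq : Rabs (Rmax (x + h) 0 ^ 2 - Rmax x 0 ^ 2 - h * (2 * Rmax x 0))
      <= Rabs h * Rabs h).
    { rewrite <- Rabs_mult, (Rabs_pos_eq (h * h)) by nra.
      apply Rabs_le. unfold Rmax. destruct (Rle_dec (x + h) 0), (Rle_dec x 0); nra. }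
    assert (Hpos : 0 < Rabs h) by now apply Rabs_pos_lt.
    replace ((Rmax (x + h) 0 ^ 2 - Rmax x 0 ^ 2) / h - (1 + 1) * Rmax x 0 ^ 1)
      with ((Rmax (x + h) 0 ^ 2 - Rmax x 0 ^ 2 - h * (2 * Rmax x 0)) / h)
      by (field; exact Hh0).
    rewrite Rabs_div by exact Hh0.
    apply Rle_lt_trans with (Rabs h); [| exact Hh].
    apply (Rmult_le_reg_r (Rabs h)); [exact Hpos |].
    unfold Rdiv. rewrite Rmult_assoc, Rinv_l by lra. lra.
  - apply is_derive_ext with (fun y => y * ramp (S (S n)) y).
    + intros y. destruct (Rle_dec y 0) as [Hy | Hy].
      * rewrite !ramp_left by lra. apply Rmult_0_r.
      * rewrite !ramp_right by lra. reflexivity.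
    + replace (INR (S (S (S n))) * ramp (S (S n)) x)
        with (1 * ramp (S (S n)) x + x * (INR (S (S n)) * ramp (S n) x)).
      * apply (is_derive_mult (fun y => y) (ramp (S (S n))) x 1 _
          (is_derive_id x) IH). intros a b. apply Rmult_comm.
      * rewrite (S_INR (S (S n))). destruct (Rle_dec x 0) as [Hx | Hx].
        -- rewrite !ramp_left by lra. ring.
        -- rewrite !ramp_right by lra. simpl pow. ring.
Qed.

Lemma continuous_ramp n x : continuous (ramp (S n)) x.
Proof.
  apply continuity_pt_filterlim.
  apply (continuity_pt_comp (fun x => Rmax x 0) (fun y => y ^ S n)).
  - intros eps Heps. exists eps. split; [exact Heps |].
    intros y [_ Hy]. simpl in *. unfold Rdist in *. apply Rabs_def2 in Hy.
    unfold Rmax. destruct (Rle_dec y 0), (Rle_dec x 0); apply Rabs_def1; lra.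
  - apply derivable_continuous_pt, derivable_pt_pow.
Qed.

Lemma quadratic_form_pos P b Q s x :
  0 < P -> b ^ 2 < 4 * P * Q -> 0 < x -> 0 < P * s ^ 2 - b * s * x + Q * x ^ 2.
Proof.
  intros HP Hb Hx.
  assert (Hx2 : 0 < x ^ 2) by (apply pow_lt; lra).
  assert (0 < (4 * P * Q - b ^ 2) * x ^ 2) by (apply Rmult_lt_0_compat; lra).
  pose proof (pow2_ge_0 (2 * P * s - b * x)).
  assert (0 < 4 * P * (P * s ^ 2 - b * s * x + Q * x ^ 2)).
  { replace (4 * P * (P * s ^ 2 - b * s * x + Q * x ^ 2))
      with ((2 * P * s - b * x) ^ 2 + (4 * P * Q - b ^ 2) * x ^ 2) by ring. lra. }
  apply (Rmult_lt_reg_l (4 * P)); lra.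
Qed.

Lemma is_derive_of_within (T : R) (g : R -> R) (t l : R) :
  is_derive_within (time_interval T) g t l -> 0 < t < T -> is_derive g t l.
Proof.
  intros Hg Ht. apply is_derive_Reals. intros eps Heps.
  destruct (is_derive_within_bound _ _ _ _ Hg (eps / 2)) as [d [Hd Hb]]; [lra |].
  assert (Hm : 0 < Rmin d (Rmin t (T - t))) by (repeat apply Rmin_pos; lra).
  exists (mkposreal _ Hm). simpl. intros h Hh0 Hh.
  pose proof (Rmin_l d (Rmin t (T - t))). pose proof (Rmin_r d (Rmin t (T - t))).
  pose proof (Rmin_l t (T - t)). pose proof (Rmin_r t (T - t)).
  specialize (Hb (t + h)). replace (t + h - t) with h in Hb by ring.
  assert (Hin : time_interval T (t + h)).
  { apply Rabs_def2 in Hh. unfold time_interval. lra. }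
  specialize (Hb Hin ltac:(lra)).
  assert (Hpos : 0 < Rabs h) by now apply Rabs_pos_lt.
  replace ((g (t + h) - g t) / h - l) with ((g (t + h) - g t - h * l) / h)
    by (field; exact Hh0).
  rewrite Rabs_div by exact Hh0.
  apply Rle_lt_trans with (eps / 2); [| lra].
  apply (Rmult_le_reg_r (Rabs h)); [exact Hpos |].
  unfold Rdiv at 1. rewrite Rmult_assoc, Rinv_l by lra. lra.
Qed.

(** The integral of [(r - a)_+^(n+1) (1 - u_r)] over [[L,z]], where
    [a = alpha + c t], integrated by parts so that it makes sense, and can be
    differentiated in time, for [u] alone. *)
Definition deficit (u : R -> R -> R) (n : nat) (alpha c L z t : R) : R :=
  ramp (S n) (z - (alpha + c * t)) * (z - u z t)
  - RInt (fun r => INR (S n) * ramp n (r - (alpha + c * t)) * (r - u r t)) L z.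

Lemma continuous_shift (g : R -> R) (b x : R) :
  continuous g (x - b) -> continuous (fun y => g (y - b)) x.
Proof.
  intros Hg. apply (continuous_comp (fun y => y - b) g); [| exact Hg].
  apply (ex_derive_continuous (fun y => y - b)). auto_derive. exact I.
Qed.

Lemma is_derive_shift (g : R -> R) (b x l : R) :
  is_derive g (x - b) l -> is_derive (fun y => g (y - b)) x l.
Proof.
  intros Hg. replace l with (scal 1 l) by (unfold scal; simpl; unfold mult; simpl; ring).
  apply (is_derive_comp g (fun y => y - b)); [exact Hg |].
  auto_derive; [exact I | ring].
Qed.

Lemma is_derive_primitive (g : R -> R) (a b L z : R) :
  (forall x, a < x < b -> continuous g x) -> a < L < b -> a < z < b ->
  is_derive (RInt g L) z (g z).
Proof.
  intros Hg HL Hz. apply is_derive_RInt with L; [| now apply Hg].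
  assert (Hm : 0 < Rmin (z - a) (b - z)) by (apply Rmin_pos; lra).
  exists (mkposreal _ Hm). intros y Hy. change (Rabs (y - z) < Rmin (z - a) (b - z)) in Hy.
  pose proof (Rmin_l (z - a) (b - z)). pose proof (Rmin_r (z - a) (b - z)).
  apply Rabs_def2 in Hy.
  apply (RInt_correct (V := R_CompleteNormedModule) g),
    (ex_RInt_continuous (V := R_CompleteNormedModule) g).
  intros x Hx. apply Hg.
  unfold Rmin, Rmax in Hx. destruct (Rle_dec L y); lra.
Qed.

Lemma deficit_dz F r1 r2 T u p q f : flux_solution F r1 r2 T u p q f ->
  forall n alpha c L z t, r1 < L < r2 -> r1 < z < r2 -> 0 <= t < T ->
  is_derive (fun z => deficit u (S n) alpha c L z t) z
    (ramp (S (S n)) (z - (alpha + c * t)) * (1 - p z t)).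
Proof.
  intros Sol n alpha c L z t HL Hz Ht. set (a := alpha + c * t).
  set (g := fun r => INR (S (S n)) * ramp (S n) (r - a)
    * (r - u r t)).
  assert (Hu : forall x, r1 < x < r2 -> is_derive (fun x => x - u x t) x (1 - p x t)).
  { intros x Hx. apply (is_derive_minus (fun x => x) (fun x => u x t)).
    - apply (is_derive_id x).
    - apply (sol_du _ _ _ _ _ _ _ _ Sol). now apply cylinder_intro. }
  replace (ramp (S (S n)) (z - a) * (1 - p z t))
    with (INR (S (S n)) * ramp (S n) (z - a) * (z - u z t)
      + ramp (S (S n)) (z - a) * (1 - p z t) - g z)
    by (unfold g; ring).
  apply (is_derive_minus
    (fun z => ramp (S (S n)) (z - a) * (z - u z t)) (RInt g L)).
  - apply (is_derive_mult (fun z => ramp (S (S n)) (z - a))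
      (fun z => z - u z t)).
    + apply is_derive_shift, is_derive_ramp.
    + now apply Hu.
    + intros x y. apply Rmult_comm.
  - apply is_derive_primitive with r1 r2; [| exact HL | exact Hz].
    intros x Hx.
    apply (continuous_mult (fun r => INR (S (S n)) * ramp (S n) (r - a))
      (fun r => r - u r t)).
    + apply (continuous_mult (fun _ => INR (S (S n)))
        (fun r => ramp (S n) (r - a))).
      * apply continuous_const.
      * apply continuous_shift, continuous_ramp.
    + apply (ex_derive_continuous (fun r => r - u r t)). exists (1 - p x t). now apply Hu.
Qed.
Lemma deficit_dt F r1 r2 T u p q f : flux_solution F r1 r2 T u p q f ->
  forall n alpha c L z t, r1 < L -> L <= z -> z < r2 -> 0 < t < T ->
  let x := fun r => r - (alpha + c * t) in
  let N := INR (S (S (S n))) in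
  let G := fun r => c * (N * (INR (S (S n)) * ramp (S n) (x r))) * (r - u r t)
                    + N * ramp (S (S n)) (x r) * f r t in
  is_derive (fun t => deficit u (S (S n)) alpha c L z t) t
    (- c * (N * ramp (S (S n)) (x z)) * (z - u z t)
     - ramp (S (S (S n))) (x z) * f z t + RInt G L z).
Proof.
  intros Sol n alpha c L z t HL HLz Hz Ht x N G.
  assert (Hramp : forall m r t, is_derive (fun t => ramp (S (S m)) (r - (alpha + c * t))) t
    (- c * (INR (S (S m)) * ramp (S m) (r - (alpha + c * t))))).
  { intros m r t'. replace (- c * (INR (S (S m)) * ramp (S m) (r - (alpha + c * t'))))
      with (scal (- c) (INR (S (S m)) * ramp (S m) (r - (alpha + c * t'))))
      by (unfold scal; simpl; unfold mult; simpl; ring).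
    apply (is_derive_comp (ramp (S (S m))) (fun t => r - (alpha + c * t))).
    - apply is_derive_ramp.
    - auto_derive; [exact I | ring]. }
  assert (Hu : forall r t, r1 < r < r2 -> 0 < t < T ->
    is_derive (fun t => r - u r t) t (0 - f r t)).
  { intros r t' Hr Ht'. apply (is_derive_minus (fun _ => r) (u r)).
    - apply (is_derive_const r).
    - apply (is_derive_of_within T); [| exact Ht'].
      apply (sol_dt _ _ _ _ _ _ _ _ Sol), cylinder_intro; lra. }
  set (h := fun t r => N * ramp (S (S n)) (r - (alpha + c * t)) * (r - u r t)).
  set (dh := fun t r =>
    - (c * (N * (INR (S (S n)) * ramp (S n) (r - (alpha + c * t)))) * (r - u r t)
       + N * ramp (S (S n)) (r - (alpha + c * t)) * f r t)).
  assert (Hh : forall t r, r1 < r < r2 -> 0 < t < T ->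
    is_derive (fun t => h t r) t (dh t r)).
  { intros t' r Hr Ht'.
    replace (dh t' r) with
      (N * (- c * (INR (S (S n)) * ramp (S n) (r - (alpha + c * t')))) * (r - u r t')
       + N * ramp (S (S n)) (r - (alpha + c * t')) * (0 - f r t'))
      by (unfold dh; ring).
    apply (is_derive_mult (fun t => N * ramp (S (S n)) (r - (alpha + c * t)))
      (fun t => r - u r t)).
    - apply (is_derive_scal (fun t => ramp (S (S n)) (r - (alpha + c * t)))). apply Hramp.
    - now apply Hu.
    - intros a b. apply Rmult_comm. }
  assert (Hloct : locally t (fun t' => 0 < t' < T)).
  { assert (Hm : 0 < Rmin t (T - t)) by (apply Rmin_pos; lra).
    exists (mkposreal _ Hm). intros t' Ht'. change (Rabs (t' - t) < Rmin t (T - t)) in Ht'.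
    pose proof (Rmin_l t (T - t)). pose proof (Rmin_r t (T - t)).
    apply Rabs_def2 in Ht'. lra. }
  assert (Hbox : forall r, L <= r <= z -> locally_2d (fun t' r' =>
    0 < t' < T /\ r1 < r' < r2) t r).
  { intros r Hr. set (m := Rmin (Rmin t (T - t)) (Rmin (r - r1) (r2 - r))).
    assert (Hm : 0 < m) by (repeat apply Rmin_pos; lra).
    pose proof (Rmin_l (Rmin t (T - t)) (Rmin (r - r1) (r2 - r))).
    pose proof (Rmin_r (Rmin t (T - t)) (Rmin (r - r1) (r2 - r))).
    pose proof (Rmin_l t (T - t)). pose proof (Rmin_r t (T - t)).
    pose proof (Rmin_l (r - r1) (r2 - r)). pose proof (Rmin_r (r - r1) (r2 - r)).
    exists (mkposreal _ Hm). simpl. intros t' r' Ht' Hr'. unfold m in *.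
    apply Rabs_def2 in Ht'. apply Rabs_def2 in Hr'. lra. }
  assert (Hshift : forall m t r,
    continuity_2d_pt (fun t r => ramp (S m) (r - (alpha + c * t))) t r).
  { intros m t' r. apply (continuity_1d_2d_pt_comp (ramp (S m))
      (fun t r => r - (alpha + c * t))).
    - apply continuity_pt_filterlim, continuous_ramp.
    - apply continuity_2d_pt_minus; [apply continuity_2d_pt_id2 |].
      apply continuity_2d_pt_plus; [apply continuity_2d_pt_const |].
      apply continuity_2d_pt_mult; [apply continuity_2d_pt_const |].
      apply continuity_2d_pt_id1. }
  assert (Hdh : forall r, L <= r <= z -> continuity_2d_pt dh t r).
  { intros r Hr. destruct (Hbox r Hr) as [b Hb].
    assert (Hcu : continuity_2d_pt (fun t r => u r t) t r).
    { intros eps. destruct (solution_continuous _ _ _ _ _ _ _ _ Sol r t ltac:(lra)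
        ltac:(lra) eps (cond_pos eps)) as [d [Hd Hc]].
      assert (Hm : 0 < Rmin b d) by (apply Rmin_pos; [apply cond_pos | exact Hd]).
      exists (mkposreal _ Hm). simpl. intros t' r' Ht' Hr'.
      pose proof (Rmin_l b d). pose proof (Rmin_r b d).
      destruct (Hb t' r' ltac:(lra) ltac:(lra)) as [Hb1 Hb2].
      apply Hc; lra. }
    assert (Hcf : continuity_2d_pt (fun t r => f r t) t r).
    { intros eps.
      assert (Hcyl : cylinder r1 r2 T (r, t)) by (apply cylinder_intro; lra).
      destruct (sol_f_cont _ _ _ _ _ _ _ _ Sol r t Hcyl eps (cond_pos eps))
        as [d [Hd Hc]].
      assert (Hm : 0 < Rmin b d) by (apply Rmin_pos; [apply cond_pos | exact Hd]).
      exists (mkposreal _ Hm). simpl. intros t' r' Ht' Hr'.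
      pose proof (Rmin_l b d). pose proof (Rmin_r b d).
      destruct (Hb t' r' ltac:(lra) ltac:(lra)) as [Hb1 Hb2].
      apply Hc; [apply cylinder_intro; lra | lra | lra]. }
    apply continuity_2d_pt_opp. apply continuity_2d_pt_plus.
    - apply continuity_2d_pt_mult.
      + apply continuity_2d_pt_mult; [apply continuity_2d_pt_const |].
        apply continuity_2d_pt_mult; [apply continuity_2d_pt_const |].
        apply continuity_2d_pt_mult; [apply continuity_2d_pt_const |].
        apply Hshift.
      + apply continuity_2d_pt_minus; [apply continuity_2d_pt_id2 | exact Hcu].
    - apply continuity_2d_pt_mult; [| exact Hcf].
      apply continuity_2d_pt_mult; [apply continuity_2d_pt_const | apply Hshift]. }
  assert (Hint : RInt G L z = - RInt (fun r => Derive (fun t => h t r) t) L z).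
  { replace (RInt (fun r => Derive (fun t => h t r) t) L z) with (RInt (dh t) L z).
    - rewrite <- (RInt_opp (V := R_CompleteNormedModule)).
      + apply RInt_ext. intros r _. change (G r = - dh t r). unfold dh, G, x. ring.
      + apply (ex_RInt_continuous (V := R_CompleteNormedModule)).
        intros r Hr. rewrite Rmin_left, Rmax_right in Hr by lra.
        intros P [e He]. destruct (Hdh r Hr e) as [d Hd].
        exists d. intros y Hy. apply He, Hd; [| exact Hy].
        rewrite Rminus_diag, Rabs_R0. apply cond_pos.
    - apply RInt_ext. intros r Hr. rewrite Rmin_left, Rmax_right in Hr by lra.
      symmetry. apply is_derive_unique, Hh; lra. }
  rewrite Hint.
  replace (- c * (N * ramp (S (S n)) (x z)) * (z - u z t)
    - ramp (S (S (S n))) (x z) * f z t + - RInt (fun r => Derive (fun t => h t r) t) L z)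
    with ((- c * (N * ramp (S (S n)) (x z)) * (z - u z t)
      + ramp (S (S (S n))) (x z) * (0 - f z t))
      - RInt (fun r => Derive (fun t => h t r) t) L z) by ring.
  apply (is_derive_minus
    (fun t => ramp (S (S (S n))) (z - (alpha + c * t)) * (z - u z t))
    (fun t => RInt (h t) L z)).
  - apply (is_derive_mult (fun t => ramp (S (S (S n))) (z - (alpha + c * t)))
      (fun t => z - u z t)).
    + apply Hramp.
    + apply Hu; lra.
    + intros a b. apply Rmult_comm.
  - apply (is_derive_RInt_param h).
    + apply (filter_imp (fun t' => 0 < t' < T)); [| exact Hloct].
      intros t' Ht' r Hr. rewrite Rmin_left, Rmax_right in Hr by lra.
      exists (dh t' r). apply Hh; lra.
    + intros r Hr. rewrite Rmin_left, Rmax_right in Hr by lra.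
      apply (continuity_2d_pt_ext_loc dh); [| now apply Hdh].
      destruct (Hbox r Hr) as [b Hb]. exists b. intros t' r' Ht' Hr'.
      destruct (Hb t' r' Ht' Hr') as [Hb1 Hb2].
      symmetry. apply is_derive_unique, Hh; lra.
    + apply (filter_imp (fun t' => 0 < t' < T)); [| exact Hloct].
      intros t' Ht'. apply (ex_RInt_continuous (V := R_CompleteNormedModule)).
      intros r Hr. rewrite Rmin_left, Rmax_right in Hr by lra.
      apply (continuous_mult (fun r => N * ramp (S (S n)) (r - (alpha + c * t')))
        (fun r => r - u r t')).
      * apply (continuous_mult (fun _ => N) (fun r => ramp (S (S n)) (r - (alpha + c * t')))).
        -- apply continuous_const.
        -- apply continuous_shift, continuous_ramp.
      * apply (ex_derive_continuous (fun r => r - u r t')). exists (1 - p r t').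
        apply (is_derive_minus (fun r => r) (fun r => u r t')).
        -- apply (is_derive_id r).
        -- apply (sol_du _ _ _ _ _ _ _ _ Sol), cylinder_intro; lra.
Qed.
Lemma solution_dt_continuous F r1 r2 T u p q f : flux_solution F r1 r2 T u p q f ->
  forall r t, r1 < r < r2 -> 0 <= t < T -> continuous (fun r => f r t) r.
Proof.
  intros Sol r t Hr Ht. apply continuity_pt_filterlim. intros eps Heps.
  destruct (sol_f_cont _ _ _ _ _ _ _ _ Sol r t (cylinder_intro _ _ _ _ _ Hr Ht)
    eps Heps) as [d [Hd Hcont]].
  exists (Rmin d (Rmin (r - r1) (r2 - r))). split; [repeat apply Rmin_pos; lra |].
  pose proof (Rmin_l d (Rmin (r - r1) (r2 - r))).
  pose proof (Rmin_r d (Rmin (r - r1) (r2 - r))).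
  pose proof (Rmin_l (r - r1) (r2 - r)). pose proof (Rmin_r (r - r1) (r2 - r)).
  intros y [_ Hy]. simpl in Hy. unfold Rdist in Hy. apply (Hcont y t); [| lra |].
  - apply cylinder_intro; [| exact Ht]. apply Rabs_def2 in Hy. lra.
  - rewrite Rminus_diag, Rabs_R0. exact Hd.
Qed.

(** With [y = F 1 - F p], [s = 1 - p] and the weight [zeta = x^N], integration
    by parts turns the time derivative of the deficit into the integral of
    [zeta'' y - zeta' y / r + F 1 zeta / r^2 - c zeta' s].
    The boundary terms at [z] vanish because [p = 1], hence [y = y_r = 0], there;
    those at [a] vanish with the weight. Dividing by [x^(N-2)] and using
    [y >= (k'/2) s^2] and [x <= r], the integrand dominates the quadratic form
    [N (N-2) (k'/2) s^2 - c N s x + (F 1 / r2^2) x^2], which is positive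
    definite by the assumption on [c] and [N]. Where [p > 1] the mixed term is
    favourable and [y >= 0] suffices. *)
Lemma deficit_dt_pos F F1 k r1 r2 T u p q f :
  threshold_flux F F1 k -> flux_solution F r1 r2 T u p q f ->
  forall n alpha c L z t k', 0 <= c -> r1 < L -> z < r2 -> 0 < t < T ->
  L <= alpha + c * t -> alpha + c * t < z -> z - (alpha + c * t) <= r1 ->
  0 < k' -> c ^ 2 * r2 ^ 2 * INR (S (S (S n))) < 2 * k' * F 1 * INR (S n) ->
  p z t = 1 ->
  (forall r, alpha + c * t <= r <= z -> 0 <= F 1 - F (p r t) /\
     (p r t <= 1 -> k' / 2 * (1 - p r t) ^ 2 <= F 1 - F (p r t))) ->
  let x := fun r => r - (alpha + c * t) in
  let N := INR (S (S (S n))) in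
  let G := fun r => c * (N * (INR (S (S n)) * ramp (S n) (x r))) * (r - u r t)
                    + N * ramp (S (S n)) (x r) * f r t in
  0 < - c * (N * ramp (S (S n)) (x z)) * (z - u z t)
     - ramp (S (S (S n))) (x z) * f z t + RInt G L z.
Proof.
  intros HF Sol n alpha c L z t k' Hc HL Hz Ht HLa Haz Hsmall Hk' Hn Hpz Hy x N G.
  pose proof (sol_r1 _ _ _ _ _ _ _ _ Sol) as Hr1.
  pose proof (flux_max_pos _ _ _ HF) as HM.
  set (a := alpha + c * t) in *.
  assert (Hcyl : forall r, r1 < r < r2 -> cylinder r1 r2 T (r, t)).
  { intros r Hr. apply cylinder_intro; lra. }
  set (z0 := fun r => ramp (S (S (S n))) (x r)).
  set (z1 := fun r => N * ramp (S (S n)) (x r)).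
  set (z2 := fun r => N * (INR (S (S n)) * ramp (S n) (x r))).
  assert (Hz0 : forall r, is_derive z0 r (z1 r)).
  { intros r. apply (is_derive_shift (ramp (S (S (S n))))), is_derive_ramp. }
  assert (Hz1 : forall r, is_derive z1 r (z2 r)).
  { intros r. apply (is_derive_scal (fun r => ramp (S (S n)) (x r))).
    apply (is_derive_shift (ramp (S (S n)))), is_derive_ramp. }
  assert (Hleft : forall r, r <= a -> z0 r = 0 /\ z1 r = 0 /\ z2 r = 0).
  { intros r Hr. unfold z0, z1, z2, x. rewrite !ramp_left by lra. lra. }
  assert (Hu : forall r, r1 < r < r2 -> is_derive (fun r => r - u r t) r (1 - p r t)).
  { intros r Hr. apply (is_derive_minus (fun r => r) (fun r => u r t)).
    - apply (is_derive_id r).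
    - now apply (sol_du _ _ _ _ _ _ _ _ Sol), Hcyl. }
  assert (HG : forall r, r1 < r < r2 -> continuous G r).
  { intros r Hr. apply (continuous_plus (fun r => c * z2 r * (r - u r t))
      (fun r => z1 r * f r t)).
    - apply (continuous_mult (fun r => c * z2 r) (fun r => r - u r t)).
      + apply (continuous_mult (fun _ => c) z2); [apply continuous_const |].
        apply (continuous_mult (fun _ => N)); [apply continuous_const |].
        apply (continuous_mult (fun _ => INR (S (S n)))); [apply continuous_const |].
        apply (continuous_shift (ramp (S n))), continuous_ramp.
      + apply (ex_derive_continuous (fun r => r - u r t)). exists (1 - p r t). now apply Hu.
    - apply (continuous_mult z1 (fun r => f r t)).
      + apply (ex_derive_continuous z1). exists (z2 r). apply Hz1.
      + apply (solution_dt_continuous _ _ _ _ _ _ _ _ Sol); [exact Hr | lra]. }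
  (* Pi collects the terms of G that are exact derivatives *)
  set (Pi := fun r => c * z1 r * (r - u r t) + z1 r * F (p r t) - F 1 * z1 r
                      + F 1 * z0 r / r).
  set (dPi := fun r => (c * z2 r * (r - u r t) + c * z1 r * (1 - p r t))
     + (z2 r * F (p r t) + z1 r * q r t) - F 1 * z2 r
     + (F 1 * z1 r * r - F 1 * z0 r) / r ^ 2).
  assert (HPi : forall r, r1 < r < r2 -> is_derive Pi r (dPi r)).
  { intros r Hr.
    apply (is_derive_plus (fun r => c * z1 r * (r - u r t) + z1 r * F (p r t) - F 1 * z1 r)
      (fun r => F 1 * z0 r / r)).
    - apply (is_derive_minus (fun r => c * z1 r * (r - u r t) + z1 r * F (p r t))
        (fun r => F 1 * z1 r)).
      + apply (is_derive_plus (fun r => c * z1 r * (r - u r t)) (fun r => z1 r * F (p r t))).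
        * apply (is_derive_mult (fun r => c * z1 r) (fun r => r - u r t)).
          -- apply (is_derive_scal z1), Hz1.
          -- now apply Hu.
          -- intros b b'. apply Rmult_comm.
        * apply (is_derive_mult z1 (fun r => F (p r t))).
          -- apply Hz1.
          -- now apply (sol_dflux _ _ _ _ _ _ _ _ Sol), Hcyl.
          -- intros b b'. apply Rmult_comm.
      + apply (is_derive_scal z1), Hz1.
    - replace ((F 1 * z1 r * r - F 1 * z0 r) / r ^ 2)
        with ((F 1 * z1 r * r - F 1 * z0 r * 1) / r ^ 2) by (field; lra).
      apply (is_derive_div (fun r => F 1 * z0 r) (fun r => r)).
      + apply (is_derive_scal z0), Hz0.
      + apply (is_derive_id r).
      + lra. }
  set (E := fun r => z2 r * (F 1 - F (p r t)) - z1 r * (F 1 - F (p r t)) / r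
     + F 1 * z0 r / r ^ 2 - c * z1 r * (1 - p r t)).
  (* H r is the integral of E over the interval from L to r *)
  set (H := fun r => RInt G L r - Pi r).
  assert (HH : forall r, L <= r <= z -> is_derive H r (E r)).
  { intros r Hr. replace (E r) with (G r - dPi r).
    - apply (is_derive_minus (RInt G L) Pi); [| apply HPi; lra].
      apply is_derive_primitive with r1 r2; [exact HG | lra | lra].
    - unfold G. fold (z2 r) (z1 r).
      rewrite (sol_eq _ _ _ _ _ _ _ _ Sol r t) by (apply Hcyl; lra).
      unfold E, dPi. field. lra. }
  assert (HL0 : H L = 0).
  { unfold H. rewrite RInt_point. destruct (Hleft L HLa) as [H0 [H1 _]].
    unfold Pi. rewrite H0, H1. unfold zero; simpl. field. lra. }
  assert (Ha0 : H a = 0).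
  { destruct HLa as [Hlt | Heq]; [| rewrite <- Heq; exact HL0].
    destruct (mean_value H E L a Hlt) as [b [Hb Hb']].
    - intros r Hr. apply HH. lra.
    - destruct (Hleft b ltac:(lra)) as [H0 [H1 H2]].
      assert (HEb : E b = 0) by (unfold E; rewrite H0, H1, H2; field; lra).
      rewrite HEb in Hb'. lra. }
  assert (HE : forall r, a < r <= z -> 0 < E r).
  { intros r Hr. destruct (Hy r ltac:(lra)) as [Hy0 Hy1].
    set (y := F 1 - F (p r t)) in *. set (s := 1 - p r t) in *.
    assert (Hxr : 0 < x r <= r1) by (unfold x; lra).
    assert (Hpow : 0 < x r ^ S n) by (apply pow_lt; lra).
    replace (E r) with (x r ^ S n * (N * INR (S (S n)) * y - N * (x r / r) * y
      - c * N * s * x r + F 1 / r ^ 2 * x r ^ 2)).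
    2:{ unfold E, z0, z1, z2. fold y. fold s. rewrite !ramp_right by lra.
        simpl. field. lra. }
    apply Rmult_lt_0_compat; [exact Hpow |].
    assert (HNn : N = INR (S n) + 2) by (unfold N; rewrite !S_INR; ring).
    assert (HNn' : INR (S (S n)) = INR (S n) + 1) by (rewrite !S_INR; ring).
    assert (Hn1 : 1 <= INR (S n)) by (rewrite S_INR; pose proof (pos_INR n); lra).
    assert (Hfrac : x r / r <= 1).
    { apply (Rmult_le_reg_r r); [lra |]. unfold Rdiv. rewrite Rmult_assoc, Rinv_l; lra. }
    assert (Hdiff : N * INR (S n) * y <= N * INR (S (S n)) * y - N * (x r / r) * y).
    { rewrite HNn'.
      assert (0 <= N * y) by (apply Rmult_le_pos; lra).
      assert (N * y * (x r / r) <= N * y * 1) by (apply Rmult_le_compat_l; lra). lra. }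
    assert (Hx2 : 0 < x r ^ 2) by (apply pow_lt; lra).
    assert (Hr2 : F 1 / r2 ^ 2 <= F 1 / r ^ 2).
    { apply Rmult_le_compat_l; [lra |]. apply Rinv_le_contravar.
      - apply pow_lt. lra.
      - apply pow_incr. lra. }
    assert (Hsource : F 1 / r2 ^ 2 * x r ^ 2 <= F 1 / r ^ 2 * x r ^ 2)
      by (apply Rmult_le_compat_r; lra).
    assert (HMr2 : 0 < F 1 / r2 ^ 2) by (apply Rdiv_lt_0_compat; [lra | apply pow_lt; lra]).
    destruct (Rle_dec 0 s) as [Hs | Hs].
    - assert (Hys : N * INR (S n) * (k' / 2) * s ^ 2 <= N * INR (S n) * y).
      { rewrite Rmult_assoc. apply Rmult_le_compat_l; [apply Rmult_le_pos; lra |].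
        apply Hy1. unfold s in Hs. lra. }
      assert (Hquad : 0 < N * INR (S n) * (k' / 2) * s ^ 2 - c * N * s * x r
        + F 1 / r2 ^ 2 * x r ^ 2).
      { apply quadratic_form_pos; [| | lra].
        - repeat apply Rmult_lt_0_compat; lra.
        - apply (Rmult_lt_reg_r (r2 ^ 2)); [apply pow_lt; lra |].
          replace (4 * (N * INR (S n) * (k' / 2)) * (F 1 / r2 ^ 2) * r2 ^ 2)
            with (N * (2 * k' * F 1 * INR (S n))) by (field; lra).
          replace ((c * N) ^ 2 * r2 ^ 2) with (N * (c ^ 2 * r2 ^ 2 * N)) by ring.
          apply Rmult_lt_compat_l; [lra | exact Hn]. }
      lra.
    - assert (0 <= N * INR (S n) * y) by (repeat apply Rmult_le_pos; lra).
      assert (0 <= c * N * (- s) * x r) by (repeat apply Rmult_le_pos; lra).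
      assert (0 < F 1 / r2 ^ 2 * x r ^ 2) by (apply Rmult_lt_0_compat; lra).
      lra. }
  assert (Hpos : 0 < H z).
  { destruct (mean_value H E a z Haz) as [b [Hb Hb']].
    - intros r Hr. apply HH. lra.
    - rewrite Ha0 in Hb'. specialize (HE b ltac:(lra)). nra. }
  assert (Hqz : q z t = 0).
  { apply (flux_critical _ _ _ _ _ _ _ _ _ _ HF Sol); try lra. }
  rewrite (sol_eq _ _ _ _ _ _ _ _ Sol z t) by (apply Hcyl; lra).
  rewrite Hqz, Hpz. fold (z0 z) (z1 z). unfold H, Pi in Hpos. rewrite Hpz in Hpos.
  replace (- c * z1 z * (z - u z t) - z0 z * (0 + F 1 / z) + RInt G L z)
    with (RInt G L z - (c * z1 z * (z - u z t) + z1 z * F 1 - F 1 * z1 z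
      + F 1 * z0 z / z)) by (field; lra).
  exact Hpos.
Qed.
Lemma Rmin_lt_split a b x : x < Rmin a b -> x < a /\ x < b.
Proof. intros H. pose proof (Rmin_l a b). pose proof (Rmin_r a b). lra. Qed.

(** Suppose that the moving point first has slope [1] at time [tau], at the place
    [A]. By [subcritical_persists], [p A] was at least [1] up to then. Over the
    times just before [tau] and the [z] between the moving point and [A], the
    deficit is positive somewhere, and it vanishes when [t = tau] or [z] is the
    moving point. So it has a positive maximum elsewhere, and there [p = 1]:
    either because [z] is an interior maximum, or because [z = A], where [p] is
    at least [1], and at most [1] since the maximum is attained from the left.
    Then [deficit_dt_pos] says that the deficit grows in time. *)
Lemma subcritical_front_step F F1 k r1 r2 T u p q f :
  threshold_flux F F1 k -> flux_solution F r1 r2 T u p q f ->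
  forall alpha c tau, 0 < c -> c ^ 2 * r2 ^ 2 < 2 * k * F 1 ->
  r1 < alpha -> alpha + c * tau < r2 -> 0 < tau < T ->
  (forall t, 0 <= t < tau -> p (alpha + c * t) t < 1) ->
  p (alpha + c * tau) tau < 1.
Proof.
  intros HF Sol alpha c tau Hc Hck Halpha HA Htau Hbefore.
  pose proof (sol_r1 _ _ _ _ _ _ _ _ Sol) as Hr1.
  pose proof (flux_max_pos _ _ _ HF) as HM.
  pose proof (flux_curvature_pos _ _ _ HF) as Hk.
  set (A := alpha + c * tau) in *.
  assert (HcT : 0 < c * tau) by (apply Rmult_lt_0_compat; lra).
  assert (HAin : r1 < A < r2) by (unfold A in *; lra).
  apply Rnot_le_lt. intros Hge.
  assert (Hpersist : forall t, 0 <= t <= tau -> 1 <= p A t).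
  { intros t Ht. apply Rnot_lt_le. intros Hlt.
    pose proof (subcritical_persists _ _ _ _ _ _ _ _ _ _ HF Sol A t tau HAin Ht
      ltac:(lra) Hlt). lra. }
  assert (HpA : p A tau = 1).
  { apply Rle_antisym; [| exact Hge]. apply Rnot_lt_le. intros Hgt.
    destruct (gradient_near _ _ _ _ _ _ _ _ Sol A tau HAin ltac:(lra) (p A tau - 1)
      ltac:(lra)) as [d [Hd Hnear]].
    set (h := Rmin (d / (1 + c)) tau / 2).
    assert (Hdc : 0 < d / (1 + c)) by (apply Rdiv_lt_0_compat; lra).
    assert (Hh : 0 < h /\ h < d / (1 + c) /\ h < tau).
    { unfold h. pose proof (Rmin_l (d / (1 + c)) tau).
      pose proof (Rmin_r (d / (1 + c)) tau).
      assert (0 < Rmin (d / (1 + c)) tau) by (apply Rmin_pos; lra). lra. }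
    assert (Hhd : h + c * h < d).
    { replace d with ((1 + c) * (d / (1 + c))) by (field; lra).
      replace (h + c * h) with ((1 + c) * h) by ring.
      apply Rmult_lt_compat_l; lra. }
    assert (0 < c * h) by (apply Rmult_lt_0_compat; lra).
    specialize (Hbefore (tau - h) ltac:(lra)).
    destruct (Hnear (alpha + c * (tau - h)) (tau - h)) as [_ Hp]; [| | lra | lra].
    - replace (alpha + c * (tau - h) - A) with (- (c * h)) by (unfold A; ring).
      rewrite Rabs_Ropp, Rabs_pos_eq; lra.
    - replace (tau - h - tau) with (- h) by ring. rewrite Rabs_Ropp, Rabs_pos_eq; lra. }
  (* k' lies strictly between c^2 r2^2 / (2 F 1) and k, which leaves room for
     the factor (n+3)/(n+1) *)
  set (k' := (k + c ^ 2 * r2 ^ 2 / (2 * F 1)) / 2).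
  assert (Hcr : 0 < c ^ 2 * r2 ^ 2) by (apply Rmult_lt_0_compat; apply pow_lt; lra).
  assert (Hq0 : 0 < c ^ 2 * r2 ^ 2 / (2 * F 1)) by (apply Rdiv_lt_0_compat; lra).
  assert (Hqk : c ^ 2 * r2 ^ 2 / (2 * F 1) < k).
  { apply (Rmult_lt_reg_r (2 * F 1)); [lra |].
    unfold Rdiv. rewrite Rmult_assoc, Rinv_l by lra. lra. }
  assert (Hk' : 0 < k' < k) by (unfold k'; lra).
  assert (Hgap : c ^ 2 * r2 ^ 2 < 2 * k' * F 1).
  { replace (2 * k' * F 1) with ((2 * k * F 1 + c ^ 2 * r2 ^ 2) / 2)
      by (unfold k'; field; lra). lra. }
  destruct (INR_unbounded (2 * (c ^ 2 * r2 ^ 2) / (2 * k' * F 1 - c ^ 2 * r2 ^ 2)))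
    as [n Hn].
  assert (HN : c ^ 2 * r2 ^ 2 * INR (S (S (S n))) < 2 * k' * F 1 * INR (S n)).
  { rewrite !S_INR.
    set (X := c ^ 2 * r2 ^ 2) in *. set (Y := 2 * k' * F 1) in *.
    assert (2 * X < INR n * (Y - X)).
    { replace (2 * X) with (2 * X / (Y - X) * (Y - X)) by (field; lra).
      apply Rmult_lt_compat_r; lra. }
    lra. }
  destruct (flux_quadratic_gap _ _ _ HF k' ltac:(lra)) as [s [Hs Hquad]].
  destruct (gradient_near _ _ _ _ _ _ _ _ Sol A tau HAin ltac:(lra) s
    ltac:(lra)) as [d [Hd Hnear]].
  rewrite HpA in Hnear.
  (* the length h + c h is small so that p is near 1 in the whole region, the
     distance to the moving point is at most r1, and the weight at most 1 *)
  set (h := Rmin (Rmin d (Rmin r1 (1 / 2)) / (1 + c)) tau / 2).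
  assert (Hm : 0 < Rmin d (Rmin r1 (1 / 2))) by (repeat apply Rmin_pos; lra).
  assert (Hmc : 0 < Rmin d (Rmin r1 (1 / 2)) / (1 + c)) by (apply Rdiv_lt_0_compat; lra).
  assert (Hh : 0 < h /\ h < Rmin d (Rmin r1 (1 / 2)) / (1 + c) /\ h < tau).
  { unfold h. pose proof (Rmin_l (Rmin d (Rmin r1 (1 / 2)) / (1 + c)) tau).
    pose proof (Rmin_r (Rmin d (Rmin r1 (1 / 2)) / (1 + c)) tau).
    assert (0 < Rmin (Rmin d (Rmin r1 (1 / 2)) / (1 + c)) tau) by (apply Rmin_pos; lra).
    lra. }
  assert (Hch : 0 < c * h) by (apply Rmult_lt_0_compat; lra).
  assert (Hhd : h + c * h < Rmin d (Rmin r1 (1 / 2))).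
  { replace (h + c * h) with ((1 + c) * h) by ring.
    replace (Rmin d (Rmin r1 (1 / 2)))
      with ((1 + c) * (Rmin d (Rmin r1 (1 / 2)) / (1 + c))) by (field; lra).
    apply Rmult_lt_compat_l; lra. }
  apply Rmin_lt_split in Hhd. destruct Hhd as [Hhd Hhd'].
  apply Rmin_lt_split in Hhd'. destruct Hhd' as [Hhr Hhalf].
  set (L := alpha + c * (tau - h)).
  assert (HLA : A = L + c * h) by (unfold A, L; ring).
  assert (HL : r1 < L).
  { unfold L. assert (0 < c * (tau - h)) by (apply Rmult_lt_0_compat; lra). lra. }
  assert (Hline : forall t, tau - h <= t <= tau -> L <= alpha + c * t <= A).
  { intros t Ht. unfold L, A.
    assert (c * (tau - h) <= c * t) by (apply Rmult_le_compat_l; lra).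
    assert (c * t <= c * tau) by (apply Rmult_le_compat_l; lra). lra. }
  assert (Hloc : forall r t, A - d < r < A + d -> tau - h <= t <= tau ->
    r1 < r < r2 /\ 1 - s < p r t < 1 + s).
  { intros r t Hr Ht. apply Hnear; [apply Rabs_def1; lra | | lra].
    apply Rabs_def1; lra. }
  set (Phi := fun z t => deficit u (S (S n)) alpha c L z t).
  assert (Hdz : forall z t, r1 < z < r2 -> 0 <= t < T ->
    is_derive (fun z => Phi z t) z
      (ramp (S (S (S n))) (z - (alpha + c * t)) * (1 - p z t))).
  { intros z t Hz Ht. apply (deficit_dz _ _ _ _ _ _ _ _ Sol); lra. }
  assert (HPhi0 : forall z t, tau - h <= t <= tau -> L <= z <= alpha + c * t -> Phi z t = 0).
  { intros z t Ht Hz. pose proof (Hline t Ht).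
    assert (HPL : Phi L t = 0).
    { unfold Phi, deficit. rewrite ramp_left, RInt_point by lra.
      unfold zero; simpl. ring. }
    destruct (proj1 Hz) as [Hlt | <-]; [| exact HPL].
    destruct (mean_value (fun z => Phi z t)
      (fun z => ramp (S (S (S n))) (z - (alpha + c * t)) * (1 - p z t)) L z Hlt)
      as [b [Hb Hb']].
    - intros y Hy. apply Hdz; lra.
    - rewrite ramp_left in Hb' by lra. lra. }
  assert (Hpos : exists z, L <= z <= A /\ 0 < Phi z (tau - h)).
  { pose proof (Hbefore (tau - h) ltac:(lra)) as HpL. fold L in HpL.
    destruct (gradient_near _ _ _ _ _ _ _ _ Sol L (tau - h) ltac:(lra) ltac:(lra)
      (1 - p L (tau - h)) ltac:(lra)) as [e [He Hne]].
    set (z := L + Rmin e (c * h) / 2).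
    assert (0 < Rmin e (c * h)) by (apply Rmin_pos; lra).
    pose proof (Rmin_l e (c * h)). pose proof (Rmin_r e (c * h)).
    exists z. split; [unfold z; lra |].
    destruct (mean_value (fun z => Phi z (tau - h))
      (fun z => ramp (S (S (S n))) (z - (alpha + c * (tau - h))) * (1 - p z (tau - h)))
      L z) as [b [Hb Hb']].
    - unfold z. lra.
    - intros y Hy. apply Hdz; unfold z in Hy; lra.
    - rewrite (HPhi0 L (tau - h)) in Hb' by (fold L; lra).
      rewrite Rminus_0_r in Hb'. rewrite Hb'. fold L.
      rewrite ramp_right by lra. unfold z in Hb.
      destruct (Hne b (tau - h)) as [_ Hpb]; [apply Rabs_def1; lra | | lra |].
      + rewrite Rminus_diag, Rabs_R0. exact He.
      + apply Rmult_lt_0_compat; [| unfold z; lra].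
        apply Rmult_lt_0_compat; [apply pow_lt; lra | lra]. }
  destruct Hpos as [z0 [Hz0 HPz0]].
  assert (Hdt : forall z t, L <= z <= A -> tau - h <= t <= tau ->
    exists l, is_derive (fun t => Phi z t) t l).
  { intros z t Hz Ht. eexists.
    apply (deficit_dt _ _ _ _ _ _ _ _ Sol); lra. }
  destruct (exists_max_trapezoid alpha c A (tau - h) tau (fun z _ t => Phi z t)
    z0 A (tau - h)) as [z [r [t [[Ht [[Haz Hzr] HrA]] Hmax]]]].
  - lra.
  - unfold trapezoid. fold L. repeat split; lra.
  - intros z r t [Ht [[Haz Hzr] HrA]] eps Heps.
    pose proof (Hline t Ht) as HLt.
    destruct (Hdt z t ltac:(lra) Ht) as [l Hl].
    destruct (is_derive_bound _ _ _ Hl 1 ltac:(lra)) as [d1 [Hd1 Hb1]].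
    set (C := Rabs l + 1).
    assert (HC : 0 < C) by (unfold C; pose proof (Rabs_pos l); lra).
    set (e := Rmin (Rmin d1 (d - (A - L))) (Rmin (1 / 2) (eps / (1 + C)))).
    assert (He : 0 < e).
    { unfold e. repeat apply Rmin_pos; try lra. apply Rdiv_lt_0_compat; lra. }
    assert (Hee : e <= d1 /\ e <= d - (A - L) /\ e <= 1 / 2 /\ (1 + C) * e <= eps).
    { repeat split.
      - eapply Rle_trans; [apply Rmin_l | apply Rmin_l].
      - eapply Rle_trans; [apply Rmin_l | apply Rmin_r].
      - eapply Rle_trans; [apply Rmin_r | apply Rmin_l].
      - apply Rle_trans with ((1 + C) * (eps / (1 + C))).
        + apply Rmult_le_compat_l; [lra |].
          eapply Rle_trans; [apply Rmin_r | apply Rmin_r].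
        + right. field. lra. }
    exists e. split; [exact He |]. intros z' r' t' [Ht' _] Hz' _ Htt.
    assert (Hspace : Rabs (Phi z' t' - Phi z t') <= 1 * Rabs (z' - z)).
    { apply (lipschitz_of_derive (fun z => Phi z t')
        (fun z => ramp (S (S (S n))) (z - (alpha + c * t')) * (1 - p z t')) z e); [| exact Hz'].
      intros y Hy. apply Rabs_def2 in Hy.
      destruct (Hloc y t') as [Hy1 Hy2]; [lra | exact Ht' |]. split.
      - apply Hdz; lra.
      - rewrite Rabs_mult. pose proof (Hline t' Ht').
        assert (Hr0 : 0 <= ramp (S (S (S n))) (y - (alpha + c * t')) <= 1).
        { unfold ramp. set (m := Rmax (y - (alpha + c * t')) 0).
          assert (Hm01 : 0 <= m <= 1) by (split; [apply Rmax_r | apply Rmax_lub; lra]).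
          split; [apply pow_le; lra |].
          rewrite <- (pow1 (S (S (S n)))). apply pow_incr. exact Hm01. }
        rewrite (Rabs_pos_eq (ramp _ _)) by lra.
        assert (Rabs (1 - p y t') <= 1) by (apply Rabs_le; lra).
        apply Rle_trans with (1 * 1); [| lra].
        apply Rmult_le_compat; [lra | apply Rabs_pos | lra | lra]. }
    assert (Htime : Rabs (Phi z t' - Phi z t) <= C * Rabs (t' - t)).
    { specialize (Hb1 t' ltac:(lra)).
      replace (Phi z t' - Phi z t) with
        ((Phi z t' - Phi z t - (t' - t) * l) + l * (t' - t)) by ring.
      eapply Rle_trans; [apply Rabs_triang |]. rewrite Rabs_mult. unfold C. lra. }
    replace (Phi z' t' - Phi z t) with ((Phi z' t' - Phi z t') + (Phi z t' - Phi z t))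
      by ring.
    eapply Rle_lt_trans; [apply Rabs_triang |].
    assert (C * Rabs (t' - t) <= C * e) by (apply Rmult_le_compat_l; lra). lra.
  - assert (HPz : 0 < Phi z t).
    { eapply Rlt_le_trans; [exact HPz0 |]. apply (Hmax z0 A (tau - h)).
      unfold trapezoid. fold L. repeat split; lra. }
    pose proof (Hline t Ht) as HLt.
    assert (Hza : alpha + c * t < z).
    { apply Rnot_le_lt. intros Hle. rewrite (HPhi0 z t Ht) in HPz by lra. lra. }
    assert (Htt : t < tau).
    { apply Rnot_le_lt. intros Hle. replace t with tau in * by lra. fold A in Hza. lra. }
    assert (Hweight : 0 < ramp (S (S (S n))) (z - (alpha + c * t))).
    { rewrite ramp_right by lra. apply pow_lt. lra. }
    assert (Hmaxz : forall y, alpha + c * t <= y <= A -> Phi y t <= Phi z t).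
    { intros y Hy. apply (Hmax y A t). unfold trapezoid. repeat split; lra. }
    pose proof (Hdz z t ltac:(lra) ltac:(lra)) as Hderz.
    assert (Hp1 : p z t <= 1).
    { apply Rnot_lt_le. intros Hgt.
      assert (0 < ramp (S (S (S n))) (z - (alpha + c * t)) * (p z t - 1))
        by (apply Rmult_lt_0_compat; lra).
      assert (0 <= ramp (S (S (S n))) (z - (alpha + c * t)) * (1 - p z t)); [| lra].
      apply (is_derive_nonneg _ _ _ (z - (alpha + c * t)) Hderz); [lra |].
      intros y Hy. apply Hmaxz. lra. }
    assert (Hp2 : 1 <= p z t).
    { destruct (Req_dec z A) as [-> | Hne]; [apply Hpersist; lra |].
      apply Rnot_lt_le. intros Hlt.
      assert (0 < ramp (S (S (S n))) (z - (alpha + c * t)) * (1 - p z t))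
        by (apply Rmult_lt_0_compat; lra).
      assert (ramp (S (S (S n))) (z - (alpha + c * t)) * (1 - p z t) <= 0); [| lra].
      apply (is_derive_nonpos _ _ _ (A - z) Hderz); [lra |].
      intros y Hy. apply Hmaxz. lra. }
    pose proof (deficit_dt _ _ _ _ _ _ _ _ Sol n alpha c L z t HL ltac:(lra) ltac:(lra)
      ltac:(lra)) as Hdert. cbv zeta in Hdert.
    pose proof (deficit_dt_pos _ _ _ _ _ _ _ _ _ _ HF Sol n alpha c L z t k' ltac:(lra)
      HL ltac:(lra) ltac:(lra) ltac:(lra) Hza ltac:(lra) ltac:(lra) HN ltac:(lra))
      as Hdpos. cbv zeta in Hdpos.
    pose proof (Rmin_l (tau - t) ((z - (alpha + c * t)) / c)).
    pose proof (Rmin_r (tau - t) ((z - (alpha + c * t)) / c)).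
    assert (Hquot : 0 < (z - (alpha + c * t)) / c) by (apply Rdiv_lt_0_compat; lra).
    pose proof (is_derive_nonpos _ _ _ (Rmin (tau - t) ((z - (alpha + c * t)) / c))
      Hdert) as Hdneg.
    apply (Rlt_irrefl 0). eapply Rlt_le_trans.
    + apply Hdpos. intros y Hy. destruct (Hloc y t) as [_ Hpy]; [lra | exact Ht |].
      split.
      * pose proof (flux_le_max _ _ _ HF (p y t) ltac:(lra)). lra.
      * intros Hpy1. apply Hquad. lra.
    + apply Hdneg; [apply Rmin_pos; lra |].
      intros t' Ht'. apply (Hmax z A t'). unfold trapezoid.
      assert (c * (t' - t) <= z - (alpha + c * t)).
      { replace (z - (alpha + c * t)) with (c * ((z - (alpha + c * t)) / c)) by (field; lra).
        apply Rmult_le_compat_l; lra. }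
      repeat split; lra.
Qed.

Lemma subcritical_front F F1 k r1 r2 T u p q f :
  threshold_flux F F1 k -> flux_solution F r1 r2 T u p q f ->
  forall alpha c t0, 0 < c -> c ^ 2 * r2 ^ 2 < 2 * k * F 1 ->
  r1 < alpha -> alpha + c * t0 < r2 -> t0 < T -> p alpha 0 < 1 ->
  forall t, 0 <= t <= t0 -> p (alpha + c * t) t < 1.
Proof.
  intros HF Sol alpha c t0 Hc Hck Halpha Hend Ht0 Hp.
  assert (Hin : forall t, 0 <= t <= t0 -> r1 < alpha + c * t < r2).
  { intros t Ht. assert (0 <= c * t) by (apply Rmult_le_pos; lra).
    assert (c * t <= c * t0) by (apply Rmult_le_compat_l; lra). lra. }
  apply (continuation (fun t => p (alpha + c * t) t < 1)).
  - now rewrite Rmult_0_r, Rplus_0_r.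
  - intros t Ht Hbefore. apply (subcritical_front_step _ _ _ _ _ _ _ _ _ _ HF Sol);
      try lra; try assumption. apply Hin. lra.
  - intros t Ht Hpt.
    destruct (gradient_near _ _ _ _ _ _ _ _ Sol (alpha + c * t) t (Hin t ltac:(lra))
      ltac:(lra) (1 - p (alpha + c * t) t) ltac:(lra)) as [d [Hd Hnear]].
    exists (d / (1 + c)). assert (Hdc : 0 < d / (1 + c)) by (apply Rdiv_lt_0_compat; lra).
    split; [exact Hdc |]. intros t' Ht' Ht0'.
    assert (Hd' : d = d / (1 + c) + c * (d / (1 + c))) by (field; lra).
    assert (0 < c * (d / (1 + c))) by (apply Rmult_lt_0_compat; lra).
    assert (0 <= c * (t' - t)) by (apply Rmult_le_pos; lra).
    assert (c * (t' - t) < c * (d / (1 + c))) by (apply Rmult_lt_compat_l; lra).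
    destruct (Hnear (alpha + c * t') t') as [_ Hp']; [| | lra | lra];
      apply Rabs_def1; lra.
Qed.
(** * Supercritical slopes decay slowly *)

(** Comparison with the affine functions of slope [lev t = 1 + K (t0 - t)],
    [K = F 1 / r1^2], on the interval between the front and its end position
    [beta]. This interval shrinks to a point at [t = t0], so an excess at time
    [0] has a maximum at an earlier time, at two points of slope [lev t > 1].
    Since [F] falls there, the second-order test gives [q >= 0] at [r] and
    [q <= 0] at [s], and the excess grows in time because
    [F (lev t) (1/s - 1/r) < K (r - s)]. *)
Lemma supercritical_decay F F1 k r1 r2 T u p q f :
  threshold_flux F F1 k -> flux_solution F r1 r2 T u p q f ->
  forall alpha c t0, 0 < c -> 0 <= t0 < T -> r1 < alpha -> alpha + c * t0 < r2 ->
  (forall t, 0 <= t <= t0 -> p (alpha + c * t) t < 1 /\ p (alpha + c * t0) t < 1) ->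
  forall r, alpha <= r < alpha + c * t0 -> p r 0 <= 1 + F 1 / r1 ^ 2 * t0.
Proof.
  intros HF Sol alpha c t0 Hc Ht0 Halpha Hbeta Hends r0 Hr0.
  pose proof (sol_r1 _ _ _ _ _ _ _ _ Sol) as Hr1.
  pose proof (flux_max_pos _ _ _ HF) as HM.
  set (beta := alpha + c * t0) in *.
  set (K := F 1 / r1 ^ 2).
  assert (Hr12 : 0 < r1 ^ 2) by (apply pow_lt; lra).
  assert (HK : 0 < K) by (now apply Rdiv_lt_0_compat).
  set (lev := fun t => 1 + K * (t0 - t)).
  assert (Hlev : forall t, t <= t0 -> 1 <= lev t).
  { intros t Ht. unfold lev. assert (0 <= K * (t0 - t)) by (apply Rmult_le_pos; lra). lra. }
  apply Rnot_lt_le. intros Hbad.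
  assert (Hbad' : lev 0 < p r0 0) by (unfold lev; rewrite Rminus_0_r; exact Hbad).
  assert (Hdiff : forall y t, r1 < y < r2 -> 0 <= t < T ->
    is_derive (fun y => u y t - lev t * y) y (p y t - lev t)).
  { intros y t Hy Ht. apply (is_derive_minus (fun y => u y t) (fun y => lev t * y)).
    - now apply (sol_du _ _ _ _ _ _ _ _ Sol), cylinder_intro.
    - auto_derive; [exact I | ring]. }
  assert (Hpos : exists y, r0 <= y <= beta /\
    0 < u y 0 - u r0 0 - (lev 0 * y - lev 0 * r0)).
  { apply NNPP. intros Hno.
    assert (p r0 0 - lev 0 <= 0); [| lra].
    apply (is_derive_nonpos _ _ _ (beta - r0) (Hdiff r0 0 ltac:(lra) ltac:(lra)));
      [lra |].
    intros y Hy. apply Rnot_lt_le. intros Hlt. apply Hno. exists y. lra. }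
  destruct Hpos as [y0 [Hy0 HZ0]].
  destruct (two_point_maximum _ _ _ _ _ _ _ _ Sol (fun y t => lev t * y) (fun _ t => lev t)
    alpha c beta 0 t0 ltac:(lra) ltac:(lra) ltac:(lra) Halpha Hbeta)
    with (s0 := r0) (r0 := y0) (t0 := 0)
    as [s [r [t [Ht [Hs [Hsr [Hr [Hps [Hpr [HZ Hmax]]]]]]]]]].
  - intros x t. auto_derive; [exact I | ring].
  - intros x t. apply continuity_2d_pt_mult; [| apply continuity_2d_pt_id1].
    unfold lev. apply continuity_2d_pt_plus; [apply continuity_2d_pt_const |].
    apply continuity_2d_pt_mult; [apply continuity_2d_pt_const |].
    apply continuity_2d_pt_minus; [apply continuity_2d_pt_const | apply continuity_2d_pt_id2].
  - intros t Ht _. destruct (Hends t Ht). specialize (Hlev t ltac:(lra)). lra.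
  - unfold trapezoid. rewrite Rmult_0_r, Rplus_0_r. repeat split; lra.
  - exact HZ0.
  - assert (Htt : t < t0).
    { apply (Rmult_lt_reg_l c); [exact Hc |]. unfold beta in Hr. lra. }
    assert (HtT : 0 <= t < T) by lra.
    assert (Hct : 0 <= c * t) by (apply Rmult_le_pos; lra).
    assert (Hl1 : 1 < lev t).
    { unfold lev. assert (0 < K * (t0 - t)) by (apply Rmult_lt_0_compat; lra). lra. }
    assert (Hcyl : forall y, alpha < y < beta -> cylinder r1 r2 T (y, t)).
    { intros y Hy. apply cylinder_intro; lra. }
    assert (Hnear : forall y, alpha < y < beta -> p y t = lev t ->
      exists eta, 0 < eta /\ y + eta <= beta /\ forall z, y < z < y + eta -> 1 < p z t).
    { intros y Hy Hpy.
      destruct (gradient_near _ _ _ _ _ _ _ _ Sol y t ltac:(lra) HtT (lev t - 1)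
        ltac:(lra)) as [e [He Hne]].
      pose proof (Rmin_l e (beta - y)). pose proof (Rmin_r e (beta - y)).
      exists (Rmin e (beta - y)). split; [apply Rmin_pos; lra |].
      split; [lra |]. intros z Hz. destruct (Hne z t) as [_ Hp].
      - apply Rabs_def1; lra.
      - rewrite Rminus_diag, Rabs_R0. exact He.
      - exact HtT.
      - rewrite Hpy in Hp. lra. }
    assert (Hqr : 0 <= q r t).
    { destruct (Hnear r ltac:(lra) Hpr) as [eta [Heta [Hreta Hp]]].
      enough (0 - q r t <= 0) by lra.
      apply (second_order_test (fun y => u y t - lev t * y) (fun y => p y t - lev t)
        (fun y => F (lev t) - F (p y t)) r _ eta Heta).
      - intros y Hy. apply Hdiff; lra.
      - intros y Hy. specialize (Hmax s y t). cbv beta in Hmax.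
        enough (u y t - u s t - (lev t * y - lev t * s)
          <= u r t - u s t - (lev t * r - lev t * s)) by lra.
        apply Hmax. unfold trapezoid. repeat split; lra.
      - intros y Hy Hgt. specialize (Hp y Hy). apply Rnot_le_lt. intros Hle.
        destruct (Rle_lt_or_eq_dec (p y t) (lev t)) as [Hlt | Heq]; [lra | |].
        + pose proof (flux_decr _ _ _ HF (p y t) (lev t)). lra.
        + rewrite Heq in Hgt. lra.
      - cbv beta. rewrite Hpr. ring.
      - apply (is_derive_minus (fun _ => F (lev t)) (fun y => F (p y t))).
        + apply (is_derive_const (F (lev t))).
        + apply (sol_dflux _ _ _ _ _ _ _ _ Sol), Hcyl. lra. }
    assert (Hqs : q s t <= 0).
    { destruct (Hnear s ltac:(lra) Hps) as [eta [Heta [Hseta Hp]]].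
      enough (q s t - 0 <= 0) by lra.
      pose proof (Rmin_l eta (r - s)). pose proof (Rmin_r eta (r - s)).
      apply (second_order_test (fun y => lev t * y - u y t) (fun y => lev t - p y t)
        (fun y => F (p y t) - F (lev t)) s _ (Rmin eta (r - s))).
      - apply Rmin_pos; lra.
      - intros y Hy. apply (is_derive_minus (fun y => lev t * y) (fun y => u y t)).
        + auto_derive; [exact I | ring].
        + apply (sol_du _ _ _ _ _ _ _ _ Sol), Hcyl. lra.
      - intros y Hy. specialize (Hmax y r t). cbv beta in Hmax.
        enough (u r t - u y t - (lev t * r - lev t * y)
          <= u r t - u s t - (lev t * r - lev t * s)) by lra.
        apply Hmax. unfold trapezoid. repeat split; lra.
      - intros y Hy Hgt. specialize (Hp y ltac:(lra)). apply Rnot_le_lt. intros Hle.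
        destruct (Rle_lt_or_eq_dec (lev t) (p y t)) as [Hlt | Heq]; [lra | |].
        + pose proof (flux_decr _ _ _ HF (lev t) (p y t)). lra.
        + rewrite <- Heq in Hgt. lra.
      - cbv beta. rewrite Hps. ring.
      - apply (is_derive_minus (fun y => F (p y t)) (fun _ => F (lev t))).
        + apply (sol_dflux _ _ _ _ _ _ _ _ Sol), Hcyl. lra.
        + apply (is_derive_const (F (lev t))). }
    assert (Hquot : 0 < (s - (alpha + c * t)) / c) by (apply Rdiv_lt_0_compat; lra).
    pose proof (Rmin_l (t0 - t) ((s - (alpha + c * t)) / c)).
    pose proof (Rmin_r (t0 - t) ((s - (alpha + c * t)) / c)).
    assert (Htime : f r t - f s t - - (K * (r - s)) <= 0).
    { apply (is_derive_within_nonpos T _ t _ (Rmin (t0 - t) ((s - (alpha + c * t)) / c))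
        (solution_dt_minus _ _ _ _ _ _ _ _ Sol r s t ((1 + K * t0) * (r - s))
          (- (K * (r - s))) ltac:(lra) ltac:(lra) HtT)); [lra | apply Rmin_pos; lra |].
      intros t' Ht' _. specialize (Hmax s r t'). cbv beta in Hmax. unfold lev in Hmax.
      enough (u r t' - u s t' - ((1 + K * (t0 - t')) * r - (1 + K * (t0 - t')) * s)
        <= u r t - u s t - ((1 + K * (t0 - t)) * r - (1 + K * (t0 - t)) * s)) by lra.
      apply Hmax. unfold trapezoid.
      assert (c * (t' - t) <= s - (alpha + c * t)).
      { replace (s - (alpha + c * t)) with (c * ((s - (alpha + c * t)) / c)) by (field; lra).
        apply Rmult_le_compat_l; lra. }
      repeat split; lra. }
    rewrite (sol_eq _ _ _ _ _ _ _ _ Sol r t), (sol_eq _ _ _ _ _ _ _ _ Sol s t),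
      Hpr, Hps in Htime by (apply Hcyl; lra).
    pose proof (flux_decr _ _ _ HF 1 (lev t) ltac:(lra) Hl1) as HFl.
    assert (Hrs : r1 ^ 2 <= r * s).
    { replace (r1 ^ 2) with (r1 * r1) by ring. apply Rmult_le_compat; lra. }
    assert (Hrspos : 0 < r * s) by lra.
    assert (HKrs : F 1 <= K * (r * s)).
    { replace (F 1) with (K * r1 ^ 2) by (unfold K; field; lra).
      apply Rmult_le_compat_l; lra. }
    assert (Hgain : 0 < (r - s) * ((K * (r * s) - F (lev t)) / (r * s))).
    { apply Rmult_lt_0_compat; [lra |]. apply Rdiv_lt_0_compat; lra. }
    replace ((r - s) * ((K * (r * s) - F (lev t)) / (r * s)))
      with (F (lev t) / r - F (lev t) / s + K * (r - s)) in Hgain by (field; lra).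
    lra.
Qed.

(** * The bound on the lifespan *)

Lemma even_derive_0 (g : R -> R) : even_fun g -> ex_derive g 0 -> Derive g 0 = 0.
Proof.
  intros Heven Hex. pose proof (Derive_correct _ _ Hex) as Hd.
  pose proof (is_derive_reflect _ _ _ Hd) as Hd'. rewrite Ropp_0 in Hd'.
  apply (is_derive_ext _ g) in Hd'; [| exact Heven].
  apply is_derive_unique in Hd'. lra.
Qed.

Lemma threshold_flux_of_potential (phi : R -> R) : smooth phi -> even_fun phi ->
  (forall s : R, 0 <= s < 1 -> Derive_n phi 2 s > 0) -> Derive_n phi 2 1 = 0 ->
  (forall s : R, s > 1 -> Derive_n phi 2 s < 0) -> Derive_n phi 3 1 < 0 ->
  threshold_flux (Derive phi) (Derive_n phi 2) (- Derive_n phi 3 1).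
Proof.
  intros Hs He Hpos H1 Hneg H3. split.
  - intros x. apply (Derive_correct (Derive phi)), (Hs 2%nat x).
  - apply even_derive_0; [exact He | apply (Hs 1%nat 0)].
  - exact Hpos.
  - exact Hneg.
  - exact H1.
  - rewrite Ropp_involutive. apply (Derive_correct (Derive_n phi 2)), (Hs 3%nat 1).
  - lra.
Qed.

Lemma is_derive_within_unique (T : R) (g : R -> R) (t l1 l2 : R) :
  0 <= t < T -> is_derive_within (time_interval T) g t l1 ->
  is_derive_within (time_interval T) g t l2 -> l1 = l2.
Proof.
  intros Ht H1 H2.
  assert (Hle : forall a b, is_derive_within (time_interval T) g t a ->
    is_derive_within (time_interval T) g t b -> a - b <= 0).
  { intros a b Ha Hb.
    apply (is_derive_within_nonpos T _ t _ 1 (is_derive_within_minus _ _ _ _ _ _ Ha Hb));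
      [exact Ht | lra |]. intros t' _ _. lra. }
  pose proof (Hle _ _ H1 H2). pose proof (Hle _ _ H2 H1). lra.
Qed.

Lemma continuous_on_cylinder r1 r2 T (g : R -> R -> R) :
  continuous_on (cylinder r1 r2 T) (fun x => g (fst x) (snd x)) ->
  forall r t, cylinder r1 r2 T (r, t) -> forall eps, 0 < eps ->
  exists d, 0 < d /\ forall r' t', cylinder r1 r2 T (r', t') ->
    Rabs (r' - r) < d -> Rabs (t' - t) < d -> Rabs (g r' t' - g r t) < eps.
Proof.
  intros Hg r t Hrt eps Heps.
  destruct (Hg (r, t) Hrt (fun y => Rabs (y - g r t) < eps)) as [d Hd].
  - now exists (mkposreal eps Heps).
  - exists (pos d). split; [apply cond_pos |]. intros r' t' Hin Hr Ht.
    apply (Hd (r', t')); [| exact Hin]. now split.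
Qed.

(** The right-hand side of the equation is continuous because it agrees with the
    continuous time derivative of [u]. *)
Lemma flux_solution_of_radial (phi : R -> R) r1 r2 T u : 0 < r1 ->
  C1_cylinder r1 r2 T u -> radial_solution phi r1 r2 T u ->
  flux_solution (Derive phi) r1 r2 T u (d_r u) (d_r (flux phi u))
    (fun r t => d_r (flux phi u) r t + flux phi u r t / r).
Proof.
  intros Hr1 [u_t [Hder [Hcr Hct]]] Hsol.
  assert (Heq : forall r t, cylinder r1 r2 T (r, t) ->
    d_r (flux phi u) r t + flux phi u r t / r = u_t r t).
  { intros r t Hrt. apply (is_derive_within_unique T (u r) t).
    - apply Hrt.
    - now apply Hsol.
    - now apply Hder. }
  split.
  - exact Hr1.
  - intros r t Hrt. apply (Derive_correct (fun s => u s t)). now apply Hder.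
  - intros r t Hrt. now apply Hsol.
  - intros r t Hrt. apply (Derive_correct (fun s => flux phi u s t)). now apply Hsol.
  - reflexivity.
  - now apply continuous_on_cylinder.
  - intros r t Hrt eps Heps.
    destruct (continuous_on_cylinder _ _ _ _ Hct r t Hrt eps Heps) as [d [Hd Hc]].
    exists d. split; [exact Hd |]. intros r' t' Hrt' Hr Ht.
    rewrite !Heq by assumption. now apply Hc.
Qed.

Theorem theorem2p3 (phi : R -> R)
  (phi_smooth : smooth phi)
  (phi_even : even_fun phi)
  (phi2_pos : forall s : R, 0 <= s < 1 -> Derive_n phi 2 s > 0)
  (phi2_1 : Derive_n phi 2 1 = 0)
  (phi2_neg : forall s : R, s > 1 -> Derive_n phi 2 s < 0)
  (phi3_1 : Derive_n phi 3 1 < 0)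
  (r1 r2 r3 r4 r5 T : R)
  (Hr1 : 0 < r1) (Hr13 : r1 < r3) (Hr34 : r3 < r4)
  (Hr45 : r4 < r5) (Hr52 : r5 < r2) (HT : 0 < T)
  (u : R -> R -> R)
  (u_C1 : C1_cylinder r1 r2 T u)
  (u_sol : radial_solution phi r1 r2 T u)
  (u_r3 : Rabs (d_r u r3 0) < 1)
  (u_r5 : Rabs (d_r u r5 0) < 1)
  (u_r4 : d_r u r4 0 >
    1 + r2 * (r2 - r1) / r1 ^ 2
        * sqrt (Derive phi 1 / (2 * Rabs (Derive_n phi 3 1)))) :
  T <= r2 * (r2 - r1) / sqrt (2 * Derive phi 1 * Rabs (Derive_n phi 3 1)).
Proof.
  pose proof (threshold_flux_of_potential _ phi_smooth phi_even phi2_pos phi2_1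
    phi2_neg phi3_1) as HF.
  pose proof (flux_solution_of_radial _ _ _ _ _ Hr1 u_C1 u_sol) as Sol.
  pose proof (flux_max_pos _ _ _ HF) as HM.
  pose proof (flux_curvature_pos _ _ _ HF) as Hk.
  rewrite (Rabs_left (Derive_n phi 3 1)) in * by exact phi3_1.
  set (k := - Derive_n phi 3 1) in *. set (M := Derive phi 1) in *.
  apply Rabs_def2 in u_r3. apply Rabs_def2 in u_r5.
  assert (HMk : 0 < 2 * M * k) by (repeat apply Rmult_lt_0_compat; lra).
  set (sg := sqrt (2 * M * k)).
  assert (Hsg : 0 < sg) by (now apply sqrt_lt_R0).
  assert (Hsg2 : sg ^ 2 = 2 * M * k) by (apply pow2_sqrt; lra).
  set (t0 := r2 * (r2 - r1) / sg).
  assert (Ht0 : 0 < t0).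
  { apply Rdiv_lt_0_compat; [| exact Hsg]. apply Rmult_lt_0_compat; lra. }
  apply Rnot_lt_le. intros HtT.
  set (c := (r5 - r3) / t0).
  assert (Hc : 0 < c) by (apply Rdiv_lt_0_compat; lra).
  assert (Hend : r3 + c * t0 = r5) by (unfold c; field; lra).
  assert (Hspeed : c ^ 2 * r2 ^ 2 < 2 * k * M).
  { assert (Hcr : c * r2 < sg).
    { replace (c * r2) with (sg * ((r5 - r3) / (r2 - r1)))
        by (unfold c, t0; field; lra).
      rewrite <- (Rmult_1_r sg) at 2. apply Rmult_lt_compat_l; [exact Hsg |].
      apply (Rmult_lt_reg_r (r2 - r1)); [lra |].
      unfold Rdiv. rewrite Rmult_assoc, Rinv_l; lra. }
    assert (0 < c * r2) by (apply Rmult_lt_0_compat; lra).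
    replace (2 * k * M) with (sg ^ 2) by (rewrite Hsg2; ring).
    replace (c ^ 2 * r2 ^ 2) with ((c * r2) * (c * r2)) by ring.
    replace (sg ^ 2) with (sg * sg) by ring. apply Rmult_le_0_lt_compat; lra. }
  assert (Hdecay : d_r u r4 0 <= 1 + M / r1 ^ 2 * t0).
  { apply (supercritical_decay _ _ _ _ _ _ _ _ _ _ HF Sol r3 c t0); try lra.
    intros t Ht. rewrite Hend. split.
    - apply (subcritical_front _ _ _ _ _ _ _ _ _ _ HF Sol r3 c t0); try lra.
      exact Hspeed.
    - apply (subcritical_persists _ _ _ _ _ _ _ _ _ _ HF Sol r5 0 t); lra. }
  assert (Hsq : sqrt (M / (2 * k)) = M / sg).
  { apply (Rmult_eq_reg_r sg); [| lra].
    replace (M / sg * sg) with M by (field; lra).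
    unfold sg. rewrite <- sqrt_mult.
    - replace (M / (2 * k) * (2 * M * k)) with (M * M) by (field; lra).
      apply sqrt_square. lra.
    - left. apply Rdiv_lt_0_compat; lra.
    - lra. }
  rewrite Hsq in u_r4.
  replace (r2 * (r2 - r1) / r1 ^ 2 * (M / sg)) with (M / r1 ^ 2 * t0) in u_r4
    by (unfold t0; field; lra).
  lra.
Qed.
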